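(* Given as input a graph $G$ that is outerplanar or a block graph, deciding whether $o(G)=\mathcal{D}$ can be done in polynomial time.
   Context: All graphs are finite and simple. A graph is outerplanar if it has a planar drawing in which all the vertices belong to the outer face. A $2$-connected graph is a connected graph that remains connected after the removal of any vertex; a $2$-connected component of a graph is a maximal $2$-connected subgraph of it. A block graph is a graph in which every $2$-connected component is a clique. The Maker-Breaker domination game on a graph $G$: two players, Dominator and Staller, alternately claim a not-yet-claimed vertex of $G$. Dominator wins if at some point the vertices she has claimed form a dominating set of $G$. Otherwise, i.e. if Staller manages to claim a vertex and all its neighbors, Staller wins. The graph $G$ has outcome $\mathcal{D}$, written $o(G)=\mathcal{D}$, if Dominator has a winning strategy whoever starts (equivalently, if Dominator has a winning strategy when playing second, since no player benefits from skipping a turn). *)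

(* Defs.v *)
From HB Require Import structures.
From mathcomp Require Import all_boot all_order all_algebra.

Set Implicit Arguments.
Unset Strict Implicit.
Unset Printing Implicit Defensive.

Record sgraph := SGraph {
  vertex :> finType;
  adj : rel vertex;
  adj_sym : symmetric adj;
  adj_irrefl : irreflexive adj
}.
Arguments adj {s} u v : rename.

Section Game.
Variable G : sgraph.
Implicit Types D S : {set G}.

Definition dominating D : Prop :=
  forall v : G, exists2 u : G, u \in D & (u == v) || adj u v.

Inductive player := Dominator | Staller.

Definition unclaimed D S (v : G) : bool := (v \notin D) && (v \notin S).

(* [dominator_wins p D S]: Dominator has a winning strategy from the position
   where she owns D, Staller owns S and p is to move.  A derivation is the tree
   of a (history-dependent) winning strategy.  Staller must have an unclaimed
   vertex in [win_staller_moves]: on a full board Dominator has won only if D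
   is dominating. *)
Inductive dominator_wins : player -> {set G} -> {set G} -> Prop :=
| win_now p D S : dominating D -> dominator_wins p D S
| win_dominator_moves D S v :
    unclaimed D S v -> dominator_wins Staller (v |: D) S ->
    dominator_wins Dominator D S
| win_staller_moves D S :
    (exists v, unclaimed D S v) ->
    (forall v, unclaimed D S v -> dominator_wins Dominator D (v |: S)) ->
    dominator_wins Staller D S.

Definition outcome_D : Prop := forall p : player, dominator_wins p set0 set0.

End Game.

Section BlockGraph.
Variable G : sgraph.

Record subgraph := Subgraph {
  sub_vertices : {set G};
  sub_adj : rel G;
  sub_adj_sym : symmetric sub_adj;
  sub_adjP : forall u v, sub_adj u v ->
    [/\ u \in sub_vertices, v \in sub_vertices & adj u v]
}.

Definition subgraph_le (H K : subgraph) : Prop :=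
  sub_vertices H \subset sub_vertices K /\ subrel (sub_adj H) (sub_adj K).

Definition connected_on (W : {set G}) (f : rel G) : Prop :=
  {in W &, forall u v,
    connect [rel x y | [&& x \in W, y \in W & f x y]] u v}.

Definition two_connected (H : subgraph) : Prop :=
  connected_on (sub_vertices H) (sub_adj H) /\
  forall x, x \in sub_vertices H ->
    connected_on (sub_vertices H :\ x) (sub_adj H).

Definition two_connected_component (H : subgraph) : Prop :=
  two_connected H /\
  forall K, two_connected K -> subgraph_le H K -> subgraph_le K H.

Definition is_clique (H : subgraph) : Prop :=
  {in sub_vertices H &, forall u v, u != v -> sub_adj H u v}.

Definition block_graph : Prop :=
  forall H, two_connected_component H -> is_clique H.

End BlockGraph.

(* Polynomial time is measured on a random access machine with unit cost:
   finitely many registers are named by a program, and the memory is addressed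
   indirectly.  Only addition and truncated subtraction are primitive (no
   multiplication), so in t steps numbers have O(t + log(input size)) bits and
   the model is polynomially equivalent to Turing machines.  Every command and
   every test costs one step; the expressions in a program have constant size. *)

Inductive expr :=
| Const of nat
| Reg of nat
| Read of expr
| Plus of expr & expr
| Minus of expr & expr.

Inductive program :=
| SetReg of nat & expr
| Write of expr & expr
| Seq of program & program
| IfNonzero of expr & program & program
| WhileNonzero of expr & program.

Record state := State { register : nat -> nat; memory : nat -> nat }.

Definition update (f : nat -> nat) (i x : nat) : nat -> nat :=
  fun j => if j == i then x else f j.

Fixpoint eval (s : state) (e : expr) : nat :=
  match e with
  | Const c => c
  | Reg r => register s r
  | Read a => memory s (eval s a)
  | Plus e1 e2 => eval s e1 + eval s e2
  | Minus e1 e2 => eval s e1 - eval s e2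
  end.

(* [exec p s t s']: started in s, p halts after exactly t steps in s'. *)
Inductive exec : program -> state -> nat -> state -> Prop :=
| exec_set_reg r e s :
    exec (SetReg r e) s 1 (State (update (register s) r (eval s e)) (memory s))
| exec_write a e s :
    exec (Write a e) s 1
      (State (register s) (update (memory s) (eval s a) (eval s e)))
| exec_seq p q s1 s2 s3 t1 t2 :
    exec p s1 t1 s2 -> exec q s2 t2 s3 -> exec (Seq p q) s1 (t1 + t2) s3
| exec_if_true e p q s s' t :
    eval s e != 0 -> exec p s t s' -> exec (IfNonzero e p q) s t.+1 s'
| exec_if_false e p q s s' t :
    eval s e = 0 -> exec q s t s' -> exec (IfNonzero e p q) s t.+1 s'
| exec_while_true e p s1 s2 s3 t1 t2 :
    eval s1 e != 0 -> exec p s1 t1 s2 -> exec (WhileNonzero e p) s2 t2 s3 ->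
    exec (WhileNonzero e p) s1 (t1 + t2).+1 s3
| exec_while_false e p s :
    eval s e = 0 -> exec (WhileNonzero e p) s 1 s.

(* The input word is in memory cells 0, 1, ..., its length in register 0. *)
Definition initial_state (w : seq bool) : state :=
  State (fun r => if r == 0 then size w else 0)
        (fun i => nat_of_bool (nth false w i)).

Definition accepting (s : state) : Prop := register s 0 != 0.

(* One program must answer, within a polynomial number of steps, whether [yes]
   holds of every input satisfying [promise]. *)
Definition polynomial_time_decidable (A : Type) (code : A -> seq bool)
    (promise yes : A -> Prop) : Prop :=
  exists (p : program) (q : {poly nat}),
  forall x : A, promise x ->
  exists (t : nat) (s : state),
    [/\ exec p (initial_state (code x)) t s,
        t <= q.[size (code x)]%R
      & accepting s <-> yes x].

(* The adjacency matrix, row by row. *)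
Definition graph_code (G : sgraph) : seq bool :=
  [seq adj u v | u <- enum G, v <- enum G].

From mathcomp Require Import all_classical all_reals all_analysis.
Import Order.TTheory GRing.Theory Num.Theory.
Import numFieldNormedType.Exports.

Local Open Scope classical_set_scope.
Local Open Scope ring_scope.

Section Outerplanar.
Variables (R : realType) (G : sgraph).

(* The edge uv is drawn as a simple curve [edge_curve u v] parametrized by [0, 1];
   [edge_curve v u] traces the same point set. *)
Record planar_drawing := PlanarDrawing {
  vertex_point : G -> R * R;
  edge_curve : G -> G -> R -> R * R;
  vertex_point_inj : injective vertex_point;
  edge_curve_continuous : forall u v, adj u v ->
    {within `[0, 1], continuous (edge_curve u v)};
  edge_curve_inj : forall u v, adj u v -> {in `[0, 1] &, injective (edge_curve u v)};
  edge_curve_start : forall u v, adj u v -> edge_curve u v 0 = vertex_point u;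
  edge_curve_end : forall u v, adj u v -> edge_curve u v 1 = vertex_point v;
  edge_curve_rev : forall u v, adj u v ->
    edge_curve u v @` `[0, 1] = edge_curve v u @` `[0, 1];
  edge_curve_vertex : forall u v w t, adj u v -> t \in `]0, 1[ ->
    edge_curve u v t <> vertex_point w;
  edge_curve_disjoint : forall u v u' v' t t', adj u v -> adj u' v' ->
    (u, v) <> (u', v') -> (u, v) <> (v', u') ->
    t \in `]0, 1[ -> t' \in `]0, 1[ -> edge_curve u v t <> edge_curve u' v' t'
}.

Definition drawn_set (d : planar_drawing) : set (R * R) :=
  [set z | (exists v, z = vertex_point d v) \/
           (exists u v, adj u v /\ (edge_curve d u v @` `[0, 1]) z)].

Definition face (d : planar_drawing) (F : set (R * R)) : Prop :=
  exists2 z, (~` drawn_set d) z & F = connected_component (~` drawn_set d) z.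

Definition outer_face (d : planar_drawing) (F : set (R * R)) : Prop :=
  face d F /\ ~ bounded_set F.

(* A vertex belongs to a face when it lies on its boundary; as faces avoid the
   drawing, this is membership in the closure. *)
Definition outerplanar : Prop :=
  exists (d : planar_drawing) (F : set (R * R)),
    outer_face d F /\ forall v : G, closure F (vertex_point d v).

End Outerplanar.

(* Main.v *)
(** The outcome is D iff there is an injective f with v adjacent to f v for every
    vertex v, i.e. a perfect matching of the bipartite double cover.

    If f exists, Dominator keeps it as a matching of the undominated vertices, all
    unclaimed, into the unclaimed ones: she answers x by the undominated z with
    f z = x if there is one, and otherwise by f x.

    If f does not exist, Hall's theorem gives an independent set S with fewer
    neighbours than elements.  Take S minimal, let T be its neighbours, and take a
    longest cycle of the bipartite graph between S and T.  A part of the remainder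
    with more vertices in S than in T is attached to the cycle at a single vertex t
    of T, since two attachments would give a longer cycle or three independent
    paths of length at least 2 with common ends.  Outerplanar graphs have no such
    paths, and in a block graph every cycle is a clique, while S is independent.
    Staller plays t: S falls into two parts that still outnumber their neighbours,
    and Dominator can answer in only one of them.

    For outerplanar graphs, three such paths and a point of the face would form a
    K_{3,3} in which independent edges are disjoint.  This is excluded by counting
    the half-turns of each path seen from the ends of the paths disjoint from it.

    The matching is found by an auction: an unassigned vertex takes its cheapest
    neighbour and raises its price by one.  If a vertex finds only neighbours of
    price n, a gap in the prices exhibits a Hall violator. *)
Require Import Defs.
From mathcomp Require Import all_boot all_order all_algebra.
From mathcomp Require Import zify ring lra.
From Stdlib Require Import Classical.

Set Implicit Arguments.
Unset Strict Implicit.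
Unset Printing Implicit Defensive.

(** * The matching strategy of Dominator *)

Section Dominator.
Variable G : sgraph.
Implicit Types (D X : {set G}) (f : G -> G).

Definition dominated D (v : G) : bool := [exists u in D, (u == v) || adj u v].

Lemma dominatedP D v :
  reflect (exists2 u : G, u \in D & (u == v) || adj u v) (dominated D v).
Proof. exact: exists_inP. Qed.

Lemma dominatedU1 D y v :
  dominated (y |: D) v = [|| y == v, adj y v | dominated D v].
Proof.
apply/dominatedP/idP => [[u]|].
  rewrite !inE => /orP[/eqP-> /orP[->//|->]|uD uv]; rewrite ?orbT //.
  by apply/or3P/Or33/dominatedP; exists u.
case/or3P=> [yv|yv|/dominatedP[u uD uv]].
- by exists y; rewrite ?inE ?eqxx // yv.
- by exists y; rewrite ?inE ?eqxx // yv orbT.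
- by exists u; rewrite ?inE ?uD ?orbT.
Qed.

(** Only undominated vertices are constrained, so that the same [f] serves during the whole game. *)
Definition matched D X f : Prop :=
  [/\ forall v, ~~ dominated D v -> unclaimed D X v /\ unclaimed D X (f v),
      forall v, ~~ dominated D v -> adj v (f v)
    & forall v w, ~~ dominated D v -> ~~ dominated D w -> f v = f w -> v = w].

(** The vertex [y] needs no precaution: any [v] with [v = y] or [f v = y] becomes dominated by it.
    Only Staller's vertex [x] has to be avoided. *)
Lemma matched_move D X f x y :
  matched D X f ->
  (forall v, ~~ dominated (y |: D) v -> v != x /\ f v != x) ->
  matched (y |: D) (x |: X) f.
Proof.
case=> uncl fadj finj ne_x.
have sub v : ~~ dominated (y |: D) v -> ~~ dominated D v.
  by apply: contra; rewrite dominatedU1 => ->; rewrite !orbT.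
split=> [v uv|v uv|v w uv uw]; [|by apply: fadj; apply: sub|by apply: finj; apply: sub].
have [v_x fv_x] := ne_x v uv.
have [/andP[vD vX] /andP[fD fX]] := uncl v (sub v uv).
rewrite /unclaimed ?inE !negb_or vD vX fD fX.
rewrite v_x fv_x !andbT; split.
  by apply: contra uv => /eqP->; rewrite dominatedU1 eqxx.
have vfv := fadj v (sub v uv).
apply: contra uv => /eqP fv; rewrite dominatedU1 -fv.
by rewrite adj_sym vfv orbT.
Qed.

Lemma matched_moveD D X f y : matched D X f -> matched (y |: D) X f.
Proof.
case=> uncl fadj finj.
have sub v : ~~ dominated (y |: D) v -> ~~ dominated D v.
  by apply: contra; rewrite dominatedU1 => ->; rewrite !orbT.
split=> [v uv|v uv|v w uv uw]; [|by apply: fadj; apply: sub|by apply: finj; apply: sub].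
have [/andP[vD vX] /andP[fD fX]] := uncl v (sub v uv).
rewrite /unclaimed ?inE !negb_or vD vX fD fX !andbT; split.
  by apply: contra uv => /eqP->; rewrite dominatedU1 eqxx.
have vfv := fadj v (sub v uv).
apply: contra uv => /eqP fv; rewrite dominatedU1 -fv.
by rewrite adj_sym vfv orbT.
Qed.

Lemma in_unclaimed D X v : (v \in unclaimed D X) = (v \notin D) && (v \notin X).
Proof. by []. Qed.

Lemma card_unclaimedD D X y : unclaimed D X y ->
  #|unclaimed (y |: D) X| < #|unclaimed D X|.
Proof.
move=> uy; apply: proper_card; apply/properP; split.
  apply/subsetP=> v; rewrite !in_unclaimed !inE.
  by case/andP; rewrite negb_or => /andP[_ ->] ->.
by exists y => //; rewrite !in_unclaimed !inE eqxx.
Qed.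

Lemma card_unclaimedX D X y :
  #|unclaimed D (y |: X)| <= #|unclaimed D X|.
Proof.
apply/subset_leq_card/subsetP=> v; rewrite !in_unclaimed !inE.
by case/andP=> ->; rewrite negb_or => /andP[_ ->].
Qed.

Lemma matched_dominator_wins p D X f : matched D X f -> dominator_wins p D X.
Proof.
have [n] := ubnP #|unclaimed D X|.
elim: n => // n IHn in p D X *; rewrite ltnS => le_n mat.
have [uncl fadj finj] := mat.
have dom : (forall v, dominated D v) -> forall q Y, dominator_wins q D Y.
  by move=> dD q Y; apply: win_now => v; apply/dominatedP.
have answer x y : unclaimed D (x |: X) y ->
    (forall v, ~~ dominated (y |: D) v -> v != x /\ f v != x) ->
    dominator_wins Dominator D (x |: X).
  move=> uy ne_x; apply: (win_dominator_moves uy); apply: IHn.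
    apply: leq_trans (card_unclaimedD uy) _.
    exact: leq_trans (card_unclaimedX D X x) _.
  exact: matched_move.
case: p.
  have [y uy|no] := pickP (unclaimed D X).
    apply: (win_dominator_moves uy); apply: IHn (matched_moveD y mat).
    exact: leq_trans (card_unclaimedD uy) _.
  by apply: dom => v; apply: contraFT (no v) => /uncl[].
have [y uy|no] := pickP (unclaimed D X); last first.
  by apply: dom => v; apply: contraFT (no v) => /uncl[].
apply: win_staller_moves; first by exists y.
move=> x ux {y uy}.
(* After the answer [z], its neighbour [x] is dominated, and by injectivity no other undominated
   vertex is matched to [x]. *)
have [z /andP[uz /eqP fz]|noz] := pickP (fun z => ~~ dominated D z && (f z == x)).
  have zx : adj z x by rewrite -fz fadj.
  have z_x : z != x by apply: contraTneq zx => ->; rewrite adj_irrefl.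
  apply: (answer x z).
    by have [/andP[zD zX] _] := uncl z uz; rewrite /unclaimed ?inE negb_or z_x zD.
  move=> v; rewrite dominatedU1 !negb_or => /and3P[zv zv' uv]; split.
    by apply: contraNneq zv' => ->.
  by apply: contraNneq zv => fv; apply/eqP/finj => //; rewrite fz.
(* From here on no undominated vertex is matched to [x]. If [x] is itself dominated, any answer will
   do, and when no vertex is left to claim, all are dominated. *)
have [dx|udx] := boolP (dominated D x).
  have [y uy|no] := pickP (unclaimed D (x |: X)).
    apply: (answer x y uy) => v; rewrite dominatedU1 !negb_or => /and3P[_ _ uv].
    by split; [apply: contraNneq uv => ->|apply: contraFneq (noz v) => ->; rewrite uv /=].
  apply: dom => v; apply: contraFT (no v) => uv; have [/andP[vD vX] _] := uncl v uv.
  by rewrite /unclaimed ?inE negb_or vD vX andbT; apply: contraNneq uv => ->.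
have xf := fadj x udx.
apply: (answer x (f x)) => [|v].
  have [_ /andP[fD fX]] := uncl x udx; rewrite /unclaimed ?inE negb_or fD fX andbT /=.
  by apply: contraTneq xf => ->; rewrite adj_irrefl.
rewrite dominatedU1 !negb_or => /and3P[_ fv uv]; split.
  by apply: contraNneq fv => ->; rewrite adj_sym.
by apply: contraFneq (noz v) => ->; rewrite uv /=.
Qed.

Lemma injective_neighbour_outcome_D f :
  injective f -> (forall v, adj v (f v)) -> outcome_D G.
Proof.
move=> finj fadj p; apply: (@matched_dominator_wins _ _ _ f); split=> // [v _|v w _ _].
  by rewrite /unclaimed ?inE.
exact: finj.
Qed.

End Dominator.

(** * Staller's strategy *)

Section Theta.
Variables (V : finType) (e : rel V).
Hypothesis e_sym : symmetric e.

(** A subdivision of K_{2,3}, not necessarily induced. *)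
Definition theta : Prop :=
  exists (x y : V) (p1 p2 p3 : seq V),
  [/\ [/\ p1 != [::], p2 != [::] & p3 != [::]],
      [/\ path e x (rcons p1 y), path e x (rcons p2 y) & path e x (rcons p3 y)]
    & uniq (x :: y :: p1 ++ p2 ++ p3)].

Lemma path_rev_rcons x y p : path e x (rcons p y) -> path e y (rcons (rev p) x).
Proof.
have -> : rcons (rev p) x = rev (belast x (rcons p y)).
  by rewrite belast_rcons rev_cons.
rewrite -[X in path _ X (rev _)](last_rcons x p y) rev_path.
by apply: sub_path => u v; rewrite e_sym.
Qed.

(** The ear [q] and the two arcs of [c] join the same two ends. If both arcs have inner vertices,
    the three form a theta; if one arc is a single edge, replacing it by the ear gives a longer
    cycle. *)
Lemma ear_theta c c1 c2 q :
  ucycle e c -> c1 \in c -> c2 \in c -> c1 != c2 ->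
  q != [::] -> uniq q -> {in q, forall k, k \notin c} ->
  path e c1 (rcons q c2) ->
  theta \/ exists2 c', ucycle e c' & size c < size c'.
Proof.
move=> /andP[cyc_c uniq_c] c1c c2c ne12 q0 uq qc pq.
have [i d def_c] := rot_to c1c.
rewrite -(rot_cycle i) def_c /= in cyc_c.
rewrite -(rot_uniq i) def_c in uniq_c.
rewrite -(size_rot i c) def_c.
have {}qc : {in q, forall k, k \notin c1 :: d}.
  by move=> k /qc; rewrite -def_c mem_rot.
rewrite -(mem_rot i) def_c inE eq_sym (negbTE ne12) /= in c2c.
case/splitPr: c2c => d1 d2 in cyc_c uniq_c qc *.
rewrite rcons_cat rcons_cons cat_path /= in cyc_c.
case/and3P: cyc_c => p1 l1 p2.
have pd1 : path e c1 (rcons d1 c2) by rewrite rcons_path p1.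
have uc : uniq (c1 :: (d1 ++ c2 :: d2) ++ q).
  rewrite -cat_cons cat_uniq uniq_c uq andbT /=.
  by apply/hasPn => k /qc.
case: d1 => [|u d1] in p1 l1 pd1 uniq_c qc uc *.
  right; exists (c1 :: q ++ c2 :: d2); last first.
    by rewrite /= size_cat addnS !ltnS -add1n leq_add2r lt0n size_eq0.
  apply/andP; split.
    by rewrite /= rcons_cat /= -cat_rcons cat_path pq last_rcons.
  rewrite (@perm_uniq _ _ (c1 :: (c2 :: d2) ++ q)) //.
  by rewrite perm_cons perm_catC.
case: d2 => [|w d2] in p2 uniq_c qc uc *.
  right; exists (c1 :: (u :: d1) ++ c2 :: rev q); last first.
    rewrite /= !size_cat /= size_rev !addnS addn0 !ltnS.
    by rewrite -[X in X < _]addn0 ltn_add2l lt0n size_eq0.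
  apply/andP; split.
    change (is_true (path e c1 (rcons ((u :: d1) ++ c2 :: rev q) c1))).
    rewrite rcons_cat rcons_cons -cat_rcons cat_path pd1 last_rcons.
    exact: path_rev_rcons.
  have <- : c1 :: ((u :: d1) ++ [:: c2]) ++ rev q = c1 :: (u :: d1) ++ c2 :: rev q.
    by rewrite -catA.
  rewrite (@perm_uniq _ _ (c1 :: ((u :: d1) ++ [:: c2]) ++ q)) //.
  by rewrite perm_cons perm_cat2l perm_rev.
left; exists c1, c2, (u :: d1), (rev (w :: d2)), q; split.
- by split=> //; rewrite -size_eq0 size_rev.
- split=> //; exact: path_rev_rcons.
- rewrite (@perm_uniq _ _ (c1 :: ((u :: d1) ++ c2 :: (w :: d2)) ++ q)) //.
  rewrite perm_cons -(cat1s c2 ((u :: d1) ++ _)) -(cat1s c2 (w :: d2)) -!catA.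
  by rewrite perm_catCA !perm_cat2l perm_cat2r perm_rev.
Qed.


End Theta.

(** * Splitting a minimal deficient set at one vertex *)

Section Separation.
Variables (V : finType) (adj : rel V) (S T : {set V}).
Hypotheses (adj_sym : symmetric adj) (disjST : [disjoint S & T]).

Definition bipartite_adj : rel V :=
  fun u v => adj u v && ((u \in S) && (v \in T) || (u \in T) && (v \in S)).
Local Notation e := bipartite_adj.

Definition nbrs (A : {set V}) : {set V} := [set v in T | [exists u in A, adj u v]].

Lemma bipartite_adj_sym : symmetric e.
Proof. by move=> u v; rewrite /e adj_sym; case: adj => //=; rewrite orbC !(andbC (v \in _)). Qed.

Lemma notST v : v \in S -> v \in T -> False.
Proof. by move=> vS vT; have := disjointFr disjST vS; rewrite vT. Qed.

Lemma bipartite_adjST u v : u \in S -> v \in T -> adj u v -> e u v.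
Proof. by rewrite /e => -> -> ->. Qed.

(** The successor along the cycle is injective and sends [S] into [T]. *)
Lemma bipartite_cycle_balanced c :
  ucycle e c -> #|S :&: [set x in c]| <= #|T :&: [set x in c]|.
Proof.
move=> /andP[cyc uc].
have /(card_imset (mem (S :&: [set x in c]))) <- : injective (next c).
  exact: can_inj (prev_next uc).
apply/subset_leq_card/subsetP=> w /imsetP[u /setIP[uS]]; rewrite inE => uc' ->{w}.
rewrite !inE mem_next uc' andbT.
have /andP[_ /orP[/andP[_ ->] //|/andP[uT _]]] := next_cycle cyc uc'.
by case: (notST uS uT).
Qed.

Hypothesis deficient : #|T| < #|S|.
Hypothesis minimal :
  forall A : {set V}, A \proper S -> A != set0 -> #|A| <= #|nbrs A|.
Hypothesis no_theta : ~ theta e.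

(** Closure under edges inside [C] makes [K] a union of connected components of the bipartite graph
    on [C]. *)
Definition excess_closed (C K : {set V}) : bool :=
  [&& K \subset C, [forall u in K, forall v in C, e u v ==> (v \in K)]
    & #|T :&: K| < #|S :&: K|].

Lemma excess_closedP (C K : {set V}) :
  reflect [/\ K \subset C, {in K & C, forall u v, e u v -> v \in K}
            & #|T :&: K| < #|S :&: K|] (excess_closed C K).
Proof.
apply: (iffP and3P) => -[KC cl lt]; split=> //.
  by move=> u v uK vC; move/forall_inP/(_ u uK)/forall_inP/(_ v vC)/implyP: cl; apply.
apply/forall_inP=> u uK; apply/forall_inP=> v vC; apply/implyP; exact: cl.
Qed.

Definition restrict (K : {set V}) : rel V :=
  fun u v => [&& u \in K, v \in K & e u v].

Lemma restrict_sym (K : {set V}) : symmetric (restrict K).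
Proof. by move=> u v; rewrite /restrict bipartite_adj_sym andbCA. Qed.

Lemma restrict_connect_in (K : {set V}) u v : connect (restrict K) u v -> u \in K -> v \in K.
Proof.
move=> /connectP[p pp ->] uK.
by elim: p u uK pp => //= w p IHp u uK /andP[/and3P[_ wK _]]; apply: IHp.
Qed.

(* The excess is additive over connected components. *)
Lemma minimal_excess_connected (C K : {set V}) : minset (excess_closed C) K ->
  {in K &, forall u v, connect (restrict K) u v}.
Proof.
move=> /minsetP[/excess_closedP[KC cl lt] min] u v uK vK.
pose A := [set w in K | connect (restrict K) u w].
have uA : u \in A by rewrite inE uK connect0.
have AK : A \subset K by apply/subsetP=> w; rewrite inE => /andP[].
have clA x y : x \in K -> y \in K -> e x y -> (x \in A) = (y \in A).
  move=> xK yK exy; rewrite !inE xK yK /=.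
  apply: (same_connect_r (sym_connect_sym (@restrict_sym K))).
  by apply: connect1; rewrite /restrict xK yK.
have split_card (U : {set V}) : #|U :&: K| = #|U :&: A| + #|U :&: (K :\: A)|.
  by rewrite -(cardsID A (U :&: K)) -setIA (setIidPr AK) setIDA.
have [ltA|geA] := ltnP #|T :&: A| #|S :&: A|.
  suff AK' : A = K by move: (vK); rewrite -[in X in X -> _]AK' inE => /andP[].
  apply: min => //; apply/excess_closedP; split=> // [|x y xA yC exy].
    exact: subset_trans KC.
  have xK := subsetP AK x xA; have yK := cl x y xK yC exy.
  by rewrite -(clA x y).
have : K :\: A = K.
  apply: min (subsetDl _ _); apply/excess_closedP; split=> [|x y|].
  - exact: subset_trans (subsetDl _ _) KC.
  - move=> /setDP[xK xA] yC exy; have yK := cl x y xK yC exy.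
    by rewrite inE yK -(clA x y) // xA.
  - by move: lt; rewrite !split_card; lia.
by move/setP/(_ u); rewrite !inE uK connect0.
Qed.

(** Once Staller owns [t], the sets [A] and [S :\: A] are two independent Hall violators. *)
Definition separated (t : V) (A : {set V}) : Prop :=
  [/\ A \subset S, [disjoint nbrs A :\ t & nbrs (S :\: A) :\ t],
      #|nbrs A :\ t| < #|A| & #|nbrs (S :\: A) :\ t| < #|S :\: A|].

(* Take the cycle c longest.  A minimal part K of the rest with excess is
   attached to c at a vertex t of T by minimality of S, and only there: a second
   attachment would give a longer cycle or a theta. *)
Lemma cycle_separated c : ucycle e c -> 1 < size c ->
  exists2 t, t \in T & exists A, separated t A.
Proof.
have [n] := ubnP (#|V| - size c); elim: n c => // n IHn c le_n cyc_c size_c.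
have longer c' : ucycle e c' -> size c < size c' ->
    exists2 t, t \in T & exists A, separated t A.
  move=> cyc' lt; apply: (IHn c' _ cyc'); last exact: ltn_trans lt.
  have : size c' <= #|V| by case/andP: cyc' => _ /card_uniqP <-; apply: max_card.
  lia.
pose C := (S :|: T) :\: [set x in c].
(* The cycle has at most as many vertices in [S] as in [T], so the excess of [S] survives its
   removal. *)
have exC : excess_closed C C.
  apply/excess_closedP; split=> //.
  have bal := bipartite_cycle_balanced cyc_c.
  have -> : T :&: C = T :\: [set x in c].
    by apply/setP=> x; rewrite !inE; case: (x \in T); rewrite ?orbT ?andbT ?andbF.
  have -> : S :&: C = S :\: [set x in c].
    by apply/setP=> x; rewrite !inE; case: (x \in S); rewrite ?orbT ?andbT ?andbF.
  have := cardsID [set x in c] S; have := cardsID [set x in c] T.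
  move: deficient; lia.
have [K minK KC] := minset_exists exC.
have /minsetP[/excess_closedP[_ cl lt] _] := minK.
have inC v : v \in S :|: T -> v \notin c -> v \in C by rewrite inE !inE => -> ->.
have Kc k : k \in K -> k \notin c by move=> /(subsetP KC); rewrite !inE => /andP[].
have [s sc sS] : exists2 s, s \in c & s \in S.
  case: (c) size_c cyc_c => [|u [|w c']] //= _ /andP[/= /andP[/andP[_ uw] _] _].
  case/orP: uw => /andP[uS wS]; first by exists u; rewrite ?inE ?eqxx.
  by exists w; rewrite ?inE ?eqxx ?orbT.
(* Without such a [t], all neighbours of [S :&: K] would lie in [K], and [S :&: K] would be a
   violator. It is a proper subset of [S], since it misses the vertex [s] of the cycle. *)
have [t tc [tT [k kK ekt]]] : exists2 t, t \in c & t \in T /\ exists2 k, k \in K & e k t.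
  pose a t := [&& t \in c, t \in T & [exists k in K, e k t]].
  have [t /and3P[tc tT /exists_inP[k kK ekt]]|no_t] := pickP a.
    by exists t => //; split=> //; exists k.
  have : #|S :&: K| <= #|nbrs (S :&: K)|.
    apply: minimal; last by rewrite -card_gt0; lia.
    apply/properP; split; first exact: subsetIl.
    by exists s => //; rewrite inE negb_and orbC (contraL (@Kc s) sc).
  have : #|nbrs (S :&: K)| <= #|T :&: K|.
    apply/subset_leq_card/subsetP=> t; rewrite inE => /andP[tT].
    move=> /exists_inP[k /setIP[kS kK] akt].
    have ekt := bipartite_adjST kS tT akt.
    rewrite inE tT (cl k) // inC ?inE ?tT ?orbT //.
    by apply: contraFN (no_t t) => tc; rewrite /a tc tT; apply/exists_inP; exists k.
  lia.
pose b t2 := [&& t2 \in c, t2 != t & [exists k2 in K, e k2 t2]].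
(* A second attachment [t2], on either side of the bipartition, yields an ear: a simple path inside
   the connected set [K] from [k] to [k2]. *)
have [t2 /and3P[t2c t2t /exists_inP[k2 k2K ekt2]]|only] := pickP b.
  have /connectP[p pp def_k2] := minimal_excess_connected minK kK k2K.
  case/shortenP: pp def_k2 => q pq uq _ def_k2.
  have qK : {in k :: q, forall x, x \in K}.
    move=> x xq; apply: restrict_connect_in (path_connect pq xq) kK.
  have := @ear_theta _ _ bipartite_adj_sym c t t2 (k :: q) cyc_c tc t2c.
  rewrite eq_sym => /(_ t2t isT uq).
  case=> [x /qK/Kc //||//|[c' cyc' lt_c']]; last exact: longer lt_c'.
  rewrite /= bipartite_adj_sym ekt rcons_path -def_k2 ekt2 andbT.
  by apply: sub_path pq => x y /and3P[].
exists t => //; exists (S :&: K).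
have nK u : u \in S :&: K -> forall v, v \in nbrs (S :&: K) :\ t -> v \in K.
  move=> _ v; rewrite !inE => /and3P[vt vT /exists_inP[w /setIP[wS wK] awv]].
  have ewv := bipartite_adjST wS vT awv.
  apply: (cl w v wK _ ewv); apply: inC; rewrite ?inE ?vT ?orbT //.
  by apply: contraFN (only v) => vc; rewrite /b vc vt; apply/exists_inP; exists w.
have n'K v : v \in nbrs (S :\: (S :&: K)) :\ t -> v \notin K.
  rewrite !inE => /and3P[vt vT /exists_inP[w /setDP[wS wK] awv]].
  have evw : e v w by rewrite bipartite_adj_sym; apply: bipartite_adjST.
  apply: contra wK => vK; rewrite inE wS /=.
  apply: (cl v w vK _ evw); apply: inC; rewrite ?inE ?wS //.
  have := only w; rewrite /b; apply: contraFN => wc; rewrite wc /=.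
  apply/andP; split; last by apply/exists_inP; exists v.
  by apply: contraTneq tT => <-; apply/negP => /(notST wS).
have S0 : S :&: K != set0 by rewrite -card_gt0; apply: leq_ltn_trans lt.
have [u uSK] := set0Pn _ S0.
have tK : t \notin K by apply: contraL tc => /Kc.
have lt1 : #|nbrs (S :&: K) :\ t| < #|S :&: K|.
  apply: leq_ltn_trans lt; apply/subset_leq_card/subsetP=> v vN.
  by have vK := nK u uSK v vN; move: vN; rewrite !inE vK => /and3P[_ ->].
(* By minimality the excess of [K] is exactly one. Hence [S :\: K] is at least as large as
   [T :\: K], and strictly larger once [t] is removed from the latter. *)
have le1 : #|S :&: K| <= #|T :&: K|.+1.
  have /minimal/(_ S0) : S :&: K \proper S.
    apply/properP; split; first exact: subsetIl.
    by exists s => //; rewrite inE negb_and orbC (contraL (@Kc s) sc).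
  move/leq_trans; apply; rewrite (cardsD1 t) -add1n.
  apply: leq_add; first exact: leq_b1.
  apply/subset_leq_card/subsetP=> v vN.
  by have vK := nK u uSK v vN; move: vN; rewrite !inE vK => /and3P[_ ->].
split=> //; first exact: subsetIl.
  rewrite disjoint_subset; apply/subsetP=> v /(nK u uSK) vK; rewrite inE.
  by apply: contraL vK => /n'K.
have : #|nbrs (S :\: (S :&: K)) :\ t| <= #|(T :\: K) :\ t|.
  apply/subset_leq_card/subsetP=> v vN; have := n'K v vN; move: vN.
  by rewrite !inE => /and3P[-> -> _] ->.
have := cardsID K T; have := cardsD1 t (T :\: K); have := cardsID K S.
have -> : S :\: (S :&: K) = S :\: K by rewrite setDIr setDv set0U.
rewrite [t \in _ :\: _]inE tK tT /=.
move: deficient le1.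
move: #|nbrs _ :\ t| #|(T :\: K) :\ t| #|T :\: K| #|S :\: K| #|T :&: K| #|S :&: K| #|T| #|S|.
by clear; lia.
Qed.

End Separation.

(** * Staller wins from a Hall violator *)

Section Staller.
Variable G : sgraph.
Implicit Types D X A S : {set G}.

Definition independent S : Prop := {in S &, forall u v, ~~ adj u v}.

(** Large cliques contain thetas, so for block graphs only the edges between an independent set and
    a set disjoint from it can be considered. *)
Definition bipartite_theta_free : Prop :=
  forall S T : {set G}, independent S -> [disjoint S & T] ->
  ~ theta (bipartite_adj (@adj G) S T).

(** Dominator can never claim a vertex that dominates [s]. The induction follows the supposed
    strategy down to the position where it stops. *)
Lemma staller_owns_neighbourhood s p D X :
  dominator_wins p D X -> {in D, forall v, v \notin X} -> s \in X ->
  (forall u, adj u s -> u \in X) -> False.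
Proof.
move=> win; elim: win => {p D X} [p D X dom|D X v /andP[vD vX] _ IH|D X [v uv] _ IH] dis sX nX.
- have [u uD /orP[/eqP us|/nX uX]] := dom s; move/negP: (dis u uD); apply=> //.
  by rewrite us.
- apply: IH => // w; rewrite !inE => /orP[/eqP->//|]; exact: dis.
- apply: (IH v uv); rewrite ?inE ?sX ?orbT // => w.
    move=> wD; rewrite !inE negb_or dis // andbT.
    by apply: contraTneq wD => ->; case/andP: uv.
  by move=> /nX wX; rewrite inE wX orbT.
Qed.

Lemma staller_turn D X : dominator_wins Staller D X -> ~ dominating D ->
  forall v, unclaimed D X v -> dominator_wins Dominator D (v |: X).
Proof. by move=> win; inversion win; subst. Qed.

Lemma dominator_turn D X : dominator_wins Dominator D X -> ~ dominating D ->
  exists2 v, unclaimed D X v & dominator_wins Staller (v |: D) X.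
Proof. by move=> win; inversion win as [| |]; subst => // _; exists v. Qed.

(** No vertex of [S] is dominated yet, and Hall's condition fails for [S] when the neighbours
    already owned by Staller are discarded. *)
Definition staller_ahead D X S : Prop :=
  [/\ independent S, {in S, forall s, unclaimed D X s},
      {in S, forall s v, adj s v -> v \notin D}
    & #|nbrs (@adj G) (~: X) S| < #|S|].

Lemma nbrs_subset (T A S : {set G}) : A \subset S ->
  nbrs (@adj G) (nbrs (@adj G) T S) A = nbrs (@adj G) T A.
Proof.
move=> AS; apply/setP=> v; rewrite !inE -andbA; congr (_ && _).
apply: andb_idl => /exists_inP[u uA auv]; apply/exists_inP; exists u => //.
exact: (subsetP AS).
Qed.

Lemma staller_ahead_wins D X S : bipartite_theta_free ->
  {in D, forall v, v \notin X} -> staller_ahead D X S ->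
  ~ dominator_wins Staller D X.
Proof.
move=> no_theta; have [n] := ubnP #|S|; elim: n => // n IHn in D X S *.
rewrite ltnS => le_n dis [ind uncl nD lt] win.
have [s sS] : exists s, s \in S by apply/set0Pn; rewrite -card_gt0; apply: leq_ltn_trans lt.
have not_dom (Y : {set G}) : {in S, forall s, s \notin Y} ->
    {in S, forall s v, adj s v -> v \notin Y} -> ~ dominating Y.
  move=> SY nY dom; have [u uY /orP[/eqP us|aus]] := dom s.
    by rewrite us in uY; move/negP: (SY s sS).
  by rewrite adj_sym in aus; move/negP: (nY s sS u aus).
have [SD SX] : {in S, forall s, s \notin D} /\ {in S, forall s, s \notin X}.
  by split=> v /uncl /andP[].
have play := staller_turn win (not_dom D SD nD).
pose T := nbrs (@adj G) (~: X) S.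
have disST : [disjoint S & T].
  rewrite disjoint_subset; apply/subsetP=> v vS; rewrite !inE negb_and.
  apply/orP; right; apply/exists_inP => -[u uS auv].
  by move/negP: (ind u v uS vS).
have uncT t : t \in T -> unclaimed D X t.
  rewrite !inE => /andP[tX /exists_inP[u uS aut]].
  by rewrite /unclaimed tX (nD u).
have disX t : unclaimed D X t -> {in D, forall v, v \notin t |: X}.
  move=> /andP[tD _] v vD; rewrite !inE negb_or dis // andbT.
  by apply: contraTneq vD => ->.
(* If [T] is empty, Staller owns all neighbours of [s] and only has to claim [s]. *)
have [T0|/set0Pn[t0 t0T]] := eqVneq T set0.
  have uS := uncl s sS.
  apply: (staller_owns_neighbourhood (s := s) (play s uS) (disX s uS)).
    by rewrite !inE eqxx.
  move=> u aus; rewrite inE; apply/orP; right.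
  have := in_set0 u; rewrite -T0 !inE => /negbT; rewrite negb_and negbK.
  case/orP=> // /exists_inP[]; exists s => //; by rewrite adj_sym.
(* A smaller violator inside [S] falls under the induction hypothesis in the same position, so [S]
   may be taken minimal. *)
have [/existsP[A /and3P[AS A0 ltA]]|] :=
    boolP [exists A : {set G}, [&& A \proper S, A != set0 & #|nbrs (@adj G) T A| < #|A|]].
  have subAS := proper_sub AS.
  apply: (IHn D X A) win => //; first exact: leq_trans (proper_card AS) le_n.
  split.
  - by move=> u v /(subsetP subAS) uS /(subsetP subAS); apply: ind.
  - by move=> u /(subsetP subAS); apply: uncl.
  - by move=> u /(subsetP subAS); apply: nD.
  - by rewrite -(nbrs_subset _ subAS).
move=> /existsPn minS.
have {}minS A : A \proper S -> A != set0 -> #|A| <= #|nbrs (@adj G) T A|.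
  by move=> AS A0; have := minS A; rewrite AS A0 /= -leqNgt.
(* An edge run back and forth counts as a cycle of length two, which is enough to start from. *)
have [c cyc_c size_c] : exists2 c, ucycle (bipartite_adj (@adj G) S T) c & 1 < size c.
  have := t0T; rewrite inE => /andP[_ /exists_inP[u uS aut]].
  exists [:: u; t0] => //=; rewrite /ucycle /= !inE (bipartite_adjST uS t0T aut).
  rewrite bipartite_adj_sym; last exact: adj_sym.
  rewrite (bipartite_adjST uS t0T aut) /= andbT.
  by apply: contraTneq aut => ->; rewrite adj_irrefl.
have [t tT [A [AS disN ltA ltB]]] :=
  cycle_separated (@adj_sym G) disST lt minS (no_theta S T ind disST) cyc_c size_c.
have := uncT t tT => ut.
have [x ux winx] := dominator_turn (play t ut) (not_dom D SD nD).
have tS v : v \in S -> v != t.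
  by move=> vS; apply: contraTneq tT => <-; apply/negP/(notST disST vS).
(* If Dominator's answer [x] lies neither in [B] nor among its remaining neighbours, Staller is
   still ahead on [B]. *)
have next (B : {set G}) : B \subset S -> #|B| < n -> x \notin B ->
    x \notin nbrs (@adj G) T B :\ t ->
    #|nbrs (@adj G) T B :\ t| < #|B| -> False.
  move=> BS leB xB xN ltN; apply: (IHn (x |: D) (t |: X) B) winx => //.
    move=> v; rewrite !inE => /orP[/eqP->|vD].
      by case/andP: ux => _; rewrite !inE.
    by have := disX t ut v vD; rewrite !inE.
  split.
  - by move=> u v /(subsetP BS) uS /(subsetP BS); apply: ind.
  - move=> u uB; have uS := subsetP BS u uB; have /andP[uD uX] := uncl u uS.
    rewrite /unclaimed !inE !negb_or uD uX (tS u uS) !andbT.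
    by apply: contraNneq xB => <-.
  - move=> u uB v auv; have uS := subsetP BS u uB.
    rewrite !inE negb_or (nD u) // andbT; apply: contraNneq xN => vx; subst x.
    have := ux; rewrite /unclaimed !inE negb_or => /andP[_ /andP[-> ->]] /=.
    by apply/andP; split; apply/exists_inP; exists u.
  - suff -> : nbrs (@adj G) (~: (t |: X)) B = nbrs (@adj G) T B :\ t by [].
    rewrite (nbrs_subset _ BS); apply/setP=> v; rewrite !inE negb_or.
    by rewrite andbA.
have ltA_S : #|A| < #|S|.
  have := cardsID A S; rewrite (setIidPr AS) => <-.
  by rewrite -[X in X < _]addn0 ltn_add2l; apply: leq_ltn_trans ltB.
have ltB_S : #|S :\: A| < #|S|.
  have := cardsID A S; rewrite (setIidPr AS) => <-.
  by rewrite -[X in X < _]add0n ltn_add2r; apply: leq_ltn_trans ltA.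
have inT (B : {set G}) v : v \in nbrs (@adj G) T B :\ t -> v \in T.
  by rewrite !inE => /and3P[_ /andP[-> ->]].
(* [A] with its neighbours other than [t] is disjoint from [S :\: A] with its own, so [x] misses one
   of the two. *)
have [/andP[xA xN]|] := boolP ((x \notin A) && (x \notin nbrs (@adj G) T A :\ t)).
  by apply: (next A) => //; apply: leq_trans ltA_S le_n.
rewrite negb_and !negbK => /orP xAN.
apply: (next (S :\: A)) => //.
- exact: subsetDl.
- exact: leq_trans ltB_S le_n.
- rewrite inE negb_and negbK; case: xAN => [->//|/inT xT].
  by apply/orP; right; apply/negP => xS; exact: (notST disST xS xT).
- case: xAN => [xA|xN]; last by rewrite (disjointFr disN xN).
  by apply/negP => /inT; apply: (notST disST (subsetP AS x xA)).
Qed.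

Lemma deficient_not_outcome_D S : bipartite_theta_free -> independent S ->
  #|nbrs (@adj G) [set: G] S| < #|S| -> ~ outcome_D G.
Proof.
move=> no_theta ind lt /(_ Staller).
apply: (@staller_ahead_wins _ _ S) => //; first by move=> v; rewrite inE.
split=> // [s _|s _ v _|]; rewrite /unclaimed ?inE //.
by rewrite setC0.
Qed.

(* Removing from A its own neighbours makes a Hall violator independent. *)
Lemma hall_violator_not_outcome_D A : bipartite_theta_free ->
  #|nbrs (@adj G) [set: G] A| < #|A| -> ~ outcome_D G.
Proof.
set N := nbrs _ _ _ => no_theta lt.
have inN v : v \in N = [exists u in A, adj u v] by rewrite !inE.
apply: (deficient_not_outcome_D (S := A :\: N) no_theta).
  move=> u v /setDP[uA uN] /setDP[vA _]; apply: contra uN => auv.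
  by rewrite inN; apply/exists_inP; exists v; rewrite // adj_sym.
(* The inequality survives because [A :&: N] is lost on both sides: a neighbour in [A] would put a
   vertex of [A :\: N] into [N]. *)
have : #|nbrs (@adj G) [set: G] (A :\: N)| <= #|N :\: A|.
  apply/subset_leq_card/subsetP=> v; rewrite !inE /= => /exists_inP[u /setDP[uA uN] auv].
  apply/andP; split; last by apply/exists_inP; exists u.
  by apply: contra uN => vA; rewrite inN; apply/exists_inP; exists v; rewrite // adj_sym.
have := cardsID N A; have := cardsID A N; rewrite setIC; move: lt.
move: #|nbrs _ _ _| #|N :\: A| #|A :\: N| #|A :&: N| #|N| #|A|.
by clear; lia.
Qed.

End Staller.

(** * Block graphs *)

Section BlockGraphs.
Variable G : sgraph.

Definition induced_adj (W : {set G}) : rel G :=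
  fun u v => [&& u \in W, v \in W & adj u v].

Fact induced_adj_sym (W : {set G}) : symmetric (induced_adj W).
Proof. by move=> u v; rewrite /induced_adj adj_sym andbCA. Qed.

Fact induced_adjP (W : {set G}) u v : induced_adj W u v -> [/\ u \in W, v \in W & adj u v].
Proof. by move=> /and3P. Qed.

Definition induced (W : {set G}) : subgraph G :=
  Subgraph (@induced_adj_sym W) (@induced_adjP W).

Lemma path_connected_on (W : {set G}) x p :
  path adj x p -> W =i x :: p -> forall f : rel G, symmetric f ->
  (forall u v, u \in W -> v \in W -> adj u v -> f u v) -> connected_on W f.
Proof.
move=> pp WE f f_sym fW u v; rewrite !WE; set r := (X in connect X u v).
have r_sym : connect_sym r by apply: sym_connect_sym => a b; rewrite /r /= f_sym andbCA.
have pr : path r x p.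
  have : all (mem W) (x :: p) by apply/allP=> a; rewrite /= -WE.
  move=> allW; apply: (sub_in_path _ allW pp).
  by move=> a b /= aW bW ab; rewrite /r /= aW bW fW.
move=> /(path_connect pr) xu /(path_connect pr) xv.
by apply: connect_trans xv; rewrite r_sym.
Qed.

(** Rotate the cycle so that it starts at the deleted vertex: the rest is a path. *)
Lemma cycle_two_connected c : ucycle adj c -> two_connected (induced [set x in c]).
Proof.
move=> /andP[cyc uc].
have adjW (W : {set G}) : W \subset [set x in c] ->
    forall u v, u \in W -> v \in W -> adj u v -> induced_adj [set x in c] u v.
  by move=> Wc u v uW vW auv; rewrite /induced_adj !(subsetP Wc).
split=> [u v|x]; rewrite /= inE => xc.
  have [i d def_c] := rot_to xc; move: cyc xc.
  rewrite -(rot_cycle i) def_c /= rcons_path => /andP[pd _] uc'.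
  apply: (path_connected_on pd) => [w|||]; last by rewrite inE.
  - by rewrite inE -def_c mem_rot.
  - exact: induced_adj_sym.
  - exact: adjW.
have [i d def_c] := rot_to xc; move: cyc uc.
rewrite -(rot_cycle i) -(rot_uniq i) def_c /= rcons_path => /andP[pd _] /andP[xd ud].
have mem_d : [set x in c] :\ x =i d.
  move=> w; rewrite !inE -(mem_rot i) def_c inE.
  by have [->|] := eqVneq w x; rewrite ?(negbTE xd).
case: d pd mem_d {def_c xd ud} => [_ mem_d u v|h d /= /andP[_ pd] mem_d]; first by rewrite mem_d.
apply: (path_connected_on pd mem_d); first exact: induced_adj_sym.
exact: (adjW _ (subsetDl _ _)).
Qed.

Implicit Types H K : subgraph G.

Definition subgraph_size (H : subgraph G) : nat :=
  #|sub_vertices H| + #|[set p : G * G | sub_adj H p.1 p.2]|.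

(** The number of vertices and edges is bounded and grows strictly along proper inclusions, so
    enlarging a non-maximal subgraph must end. *)
Lemma two_connected_in_component H : two_connected H ->
  exists2 K, two_connected_component K & subgraph_le H K.
Proof.
have [n] := ubnP (#|G| + #|{: G * G}| - subgraph_size H).
elim: n H => // n IHn H le_n conn_H.
have [max_H|] := classic
    (forall K : subgraph G, two_connected K -> subgraph_le H K -> subgraph_le K H).
  by exists H => //; split.
move=> /not_all_ex_not[K not_max].
have [conn_K not_sub] := imply_to_and _ _ not_max.
have [[subV subE] not_KH] := imply_to_and _ _ not_sub.
have subE' : [set p : G * G | sub_adj H p.1 p.2] \subset [set p | sub_adj K p.1 p.2].
  by apply/subsetP=> p; rewrite !inE => /subE.
have leV := subset_leqif_cards subV; have leE := subset_leqif_cards subE'.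
have lt : subgraph_size H < subgraph_size K.
  rewrite /subgraph_size ltn_neqAle (leq_add leV leE) andbT.
  apply: contra_notN not_KH => /eqP eq_size.
  have := leqif_add leV leE; rewrite /leqif eq_size eqxx => -[_ /esym/andP[eqV eqE]].
  split; first by rewrite (eqP eqV).
  move=> u v uv; have : (u, v) \in [set p | sub_adj K p.1 p.2] by rewrite inE.
  by rewrite -(eqP eqE) inE.
have le_K : subgraph_size K <= #|G| + #|{: G * G}| by apply: leq_add; apply: max_card.
have [|L conn_L [subV' subE'']] := IHn K _ conn_K.
  by move: lt le_K le_n; clear; lia.
exists L => //; split; first exact: subset_trans subV'.
by move=> u v /subE /subE''.
Qed.

Lemma block_graph_cycle (c : seq G) : block_graph G -> ucycle adj c ->
  {in c &, forall u v, u != v -> adj u v}.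
Proof.
move=> blockG /cycle_two_connected/two_connected_in_component[K compK [subV _]].
move=> u v uc vc uv; have inK w : w \in c -> w \in sub_vertices K.
  by move=> wc; apply: (subsetP subV); rewrite inE.
by have /sub_adjP[] := blockG K compK u v (inK u uc) (inK v vc) uv.
Qed.

(** Two of the paths form a cycle, hence a clique, with at most one vertex in the independent set
    [S]. But every edge of this cycle has an end in [S], and one vertex cannot cover a cycle of
    length at least four. *)
Lemma block_graph_theta_free : block_graph G -> bipartite_theta_free G.
Proof.
move=> blockG S T ind disST [x [y [p1 [p2 [p3 [[p1_0 p2_0 _] [pp1 pp2 _] uniq_p]]]]]].
have e_sym := bipartite_adj_sym S T (@adj_sym G).
pose c := x :: p1 ++ y :: rev p2.
have cyc_c : ucycle adj c.
  apply/andP; split.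
    rewrite /c /= rcons_cat rcons_cons -cat_rcons cat_path last_rcons.
    have sub : subrel (bipartite_adj (@adj G) S T) adj by move=> u v /andP[].
    by rewrite (sub_path sub pp1) (sub_path sub (path_rev_rcons e_sym pp2)).
  have : uniq ((x :: y :: p1 ++ p2) ++ p3) by rewrite /= -catA.
  rewrite cat_uniq => /andP[uq _]; rewrite (@perm_uniq _ _ (x :: y :: p1 ++ p2)) //.
  rewrite perm_cons -cat1s -(cat1s y (p1 ++ p2)) perm_catCA !perm_cat2l.
  by rewrite perm_rev.
have no2 u v : u \in c -> v \in c -> u \in S -> v \in S -> u = v.
  move=> uc vc uS vS; apply/eqP; apply: contraT => uv.
  have auv := block_graph_cycle blockG cyc_c uc vc uv.
  by rewrite (negbTE (ind u v uS vS)) in auv.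
have in_c u : u \in p1 ++ p2 -> u \in c.
  by rewrite mem_cat !inE mem_cat !inE mem_rev => /orP[]->; rewrite !orbT.
have x_c : x \in c by exact: mem_head.
have y_c : y \in c by rewrite /c inE mem_cat inE eqxx !orbT.
have inST z p w : p != [::] -> path (bipartite_adj (@adj G) S T) z (rcons p w) ->
    z \in S \/ exists2 h, h \in p & h \in S.
  case: p => // h p _ /= /andP[/andP[_ /orP[/andP[zS _]|/andP[_ hS]]] _]; first by left.
  by right; exists h; rewrite ?inE ?eqxx.
have disj h1 h2 : h1 \in p1 -> h2 \in p2 -> h1 \in S -> h2 \in S -> False.
  move=> h1p h2p h1S h2S; move: uniq_p.
  have := no2 h1 h2 _ _ h1S h2S; rewrite !in_c ?mem_cat ?h1p ?h2p ?orbT // => /(_ isT isT) eq_h.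
  move=> /= /and3P[_ _]; rewrite cat_uniq => /and3P[_ /hasPn/(_ h2) no_h2 _].
  by move: no_h2; rewrite mem_cat h2p -eq_h /= h1p => /(_ isT).
have p_rev (p : seq G) : p != [::] -> rev p != [::] by rewrite -!size_eq0 size_rev.
have [xS|[h1 h1p h1S]] := inST _ _ _ p1_0 pp1; last first.
  have [xS|[h2 h2p h2S]] := inST _ _ _ p2_0 pp2; last exact: (disj h1 h2).
  have := no2 x h1 x_c _ xS h1S; rewrite in_c ?mem_cat ?h1p // => /(_ isT) xh.
  by move: uniq_p; rewrite /= inE mem_cat xh h1p orbT.
have [yS|[h1 h1p h1S]] := inST _ _ _ (p_rev _ p1_0) (path_rev_rcons e_sym pp1); last first.
  rewrite mem_rev in h1p.
  have := no2 x h1 x_c _ xS h1S; rewrite in_c ?mem_cat ?h1p // => /(_ isT) xh.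
  by move: uniq_p; rewrite /= inE mem_cat xh h1p orbT.
have xy := no2 x y x_c y_c xS yS.
by move: uniq_p; rewrite /= inE xy eqxx.
Qed.

End BlockGraphs.

(** * The auction algorithm *)

Section Auction.
Variables (V : finType) (e : rel V).
Local Notation n := #|V|.

(** Both sides of the bipartite double cover are copies of [V]: [price] and [owner] live on the side
    of the goods, [assigned] on the side of the bidders. *)
Record auction := Auction {
  price : V -> nat;
  owner : V -> option V;
  assigned : V -> bool
}.
Implicit Types a b : auction.

Definition start : auction := Auction (fun _ => 0) (fun _ => None) (fun _ => false).

Definition assign a u v : auction := Auction
  (fun w => if w == v then (price a v).+1 else price a w)
  (fun w => if w == v then Some u else owner a w)
  (fun w => if w == u then true else if owner a v == Some w then false else assigned a w).

Definition priced_out a u : Prop := forall v, e u v -> n <= price a v.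

Definition cheapest a u v : Prop :=
  [/\ e u v, price a v < n & forall w, e u w -> price a v <= price a w].

(** A relation, so that the choice among equally cheap neighbours is left to the program. *)
Inductive bid a u : auction -> Prop :=
| bid_none : assigned a u \/ priced_out a u -> bid a u a
| bid_assign v : ~~ assigned a u -> cheapest a u v -> bid a u (assign a u v).

(* Prices never decrease, so an owner stays within one unit of its best offer. *)
Definition fair a : Prop :=
  [/\ forall v, price a v <= n,
      forall v, 0 < price a v -> owner a v != None,
      forall v u, owner a v = Some u ->
        [/\ assigned a u, e u v & forall w, e u w -> price a v <= (price a w).+1],
      forall v w, owner a v != None -> owner a v = owner a w -> v = w
    & forall u, assigned a u -> exists v, owner a v = Some u].

Lemma fair_start : fair start.
Proof. by []. Qed.

Lemma fair_bid a u b : fair a -> bid a u b -> fair b.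
Proof.
move=> [le_n own fit inj match_u] [//|v nau [uv lt_n min_v]].
have nown w : owner a w != Some u.
  by apply/eqP => /fit[au]; rewrite au in nau.
split=> /=.
- by move=> w; case: eqP => // _.
- by move=> w; case: eqP => // _; apply: own.
- move=> w x; case: (eqVneq w v) => [->{w} [<-]|wv ow].
    by rewrite eqxx; split=> // w uw; case: eqP => _; rewrite ltnS ?leqnSn ?min_v.
  have [ax xw fitx] := fit w x ow.
  have xu : x != u by apply: contraNneq (nown w) => <-; rewrite ow.
  rewrite (negbTE xu); split=> //.
    (* Only the owner of [v] is displaced; by injectivity it owns nothing else. *)
    case: eqP => // ovx; case/negP: wv; apply/eqP/inj; first by rewrite ow.
    by rewrite ow ovx.
  by move=> y /fitx; case: eqP => [->|//] /leqW.
- move=> w x; case: (eqVneq w v) => [->|wv]; case: (eqVneq x v) => [->|xv] // ow.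
  + by move=> eq_x; have := nown x; rewrite -eq_x eqxx.
  + by move=> eq_w; have := nown w; rewrite eq_w eqxx.
  + exact: inj.
- move=> w; case: (eqVneq w u) => [-> _|wu]; first by exists v; rewrite eqxx.
  case: eqP => // ovw /match_u[x ox]; exists x; case: eqP => // xv.
  by case: ovw; rewrite -xv.
Qed.

Definition total a : nat := \sum_v price a v.

Lemma total_assign a u v : total (assign a u v) = (total a).+1.
Proof.
rewrite /total (bigD1 v) //= [in RHS](bigD1 v) //= eqxx addSn; congr _.+1.
by congr (_ + _); apply: eq_bigr => w /negbTE ->.
Qed.

Definition settled a : Prop := forall u, assigned a u \/ priced_out a u.

Inductive bids a : seq V -> auction -> Prop :=
| bids_nil : bids a [::] a
| bids_cons u b us c : bid a u b -> bids b us c -> bids a (u :: us) c.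

Lemma bids_rcons a us b u c : bids a us b -> bid b u c -> bids a (rcons us u) c.
Proof.
move=> bs; elim: bs c => [d|d v d' vs f dv _ IH] c bc /=.
  exact: bids_cons bc (bids_nil _).
exact: bids_cons dv (IH c bc).
Qed.

Lemma fair_bids a us b : fair a -> bids a us b -> fair b.
Proof. by move=> fa bs; elim: bs fa => // c u d us' f cd _ IH /fair_bid/(_ cd). Qed.

(** A pass of bids that changes something raises a price and cannot start from a settled auction:
    settled auctions stay put. *)
Lemma bids_total a us b : bids a us b ->
  [\/ b = a /\ {in us, forall u, assigned a u \/ priced_out a u}
    | total a < total b /\ ~ settled a].
Proof.
elim=> [c|c u d us' f]; first by left.
move=> [out|v nu [uv lt_n _]] _ [[-> out_us]|[lt ns]].
- by left; split=> // w; rewrite inE => /orP[/eqP->|/out_us].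
- by right.
- right; rewrite total_assign; split=> // /(_ u)[]; first exact/negP.
  by move=> /(_ v uv); rewrite leqNgt lt_n.
- right; rewrite total_assign in lt; split; first exact: ltnW.
  by move=> /(_ u)[]; [apply/negP|move=> /(_ v uv); rewrite leqNgt lt_n].
Qed.

Inductive rounds : nat -> auction -> Prop :=
| rounds0 : rounds 0 start
| roundsS k a b : rounds k a -> bids a (enum V) b -> rounds k.+1 b.

(** Each round started unsettled raises the total price. A total of [n * n] forces every price up to
    its bound [n], and then every vertex is priced out. *)
Lemma rounds_settled a : rounds (n * n) a -> fair a /\ settled a.
Proof.
have main k b : rounds k b -> fair b /\ (settled b \/ k <= total b).
  elim=> [|{}k {}a {}b _ [fa IH] bs]; first by split; [exact: fair_start|right].
  split; first exact: fair_bids bs.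
  have [[-> out]|[lt ns]] := bids_total bs.
    by left=> u; apply: out; rewrite mem_enum.
  by right; case: IH => // le_k; apply: leq_ltn_trans lt.
move=> /main[fa [|le_t]]; split=> // u; right=> v uv.
have [le_n _ _ _ _] := fa; apply: contraTT le_t; rewrite -!ltnNge => lt_v.
rewrite /total (bigD1 v) //=.
have -> : n * n = n + \sum_(w | w != v) n.
  by rewrite -[in LHS](sum_nat_const V n) (bigD1 v).
by rewrite -addSn leq_add // leq_sum.
Qed.

Lemma settled_matching a : fair a -> (forall u, assigned a u) ->
  exists2 f : V -> V, injective f & forall u, e u (f u).
Proof.
move=> [_ _ fit _ match_u] all_a.
have ex u : exists v, owner a v == Some u.
  by have [v ov] := match_u u (all_a u); exists v; apply/eqP.
exists (fun u => xchoose (ex u)) => [u v eq_f|u].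
  have := xchooseP (ex u); have := xchooseP (ex v); rewrite -eq_f => /eqP-> /eqP[].
  by [].
by have /eqP/fit[] := xchooseP (ex u).
Qed.

(* If every price from 1 to n occurred, all the vertices would be owned, and u0
   would be an owner. *)
Lemma price_gap a u0 : fair a -> ~~ assigned a u0 ->
  exists2 k, 0 < k <= n & forall v, price a v != k.
Proof.
move=> [le_n own fit inj match_u] nu0.
pose hit (k : 'I_n) := [exists v, price a v == k.+1].
have [/forallP all_hit|/forallPn[k /existsPn no_k]] := boolP [forall k, hit k]; last first.
  by exists k.+1 => //=.
have ex (k : 'I_n) : exists v, price a v == k.+1 by apply/existsP/all_hit.
pose g (k : 'I_n) := xchoose (ex k).
have gP k : price a (g k) = k.+1 by apply/eqP/(xchooseP (ex k)).
have g_inj : injective g.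
  by move=> k l eq_g; apply: val_inj; apply: succn_inj; rewrite -!gP eq_g.
have owned v : owner a v != None.
  apply: own; have /codomP[k ->] : v \in codom g by apply: inj_card_onto; rewrite ?card_ord.
  by rewrite gP.
pose h v := odflt u0 (owner a v).
have hP v : owner a v = Some (h v) by rewrite /h; case: owner (owned v).
have h_inj : injective h.
  by move=> v w eq_h; apply: inj; rewrite ?owned // !hP eq_h.
have [v _ hv] : exists2 v, v \in V & h v = u0.
  have [h' _ hK] := injF_bij h_inj; by exists (h' u0); rewrite ?inE ?hK.
by have [] := fit v u0 _; rewrite ?hP ?hv // (negbTE nu0).
Qed.

(** Choose a price [k] that does not occur and let [A] consist of the vertices seeing only prices at
    least [k]. A vertex priced at least [k] costs more than [k], so by fairness its owner belongs to
    [A]. These owners are distinct, and the unassigned [u0] is one more element of [A]. *)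
Lemma settled_violator a u0 : fair a -> settled a -> ~~ assigned a u0 ->
  exists A : {set V}, #|[set v | [exists u in A, e u v]]| < #|A|.
Proof.
move=> fa sa nu0; have [k /andP[k0 kn] no_k] := price_gap fa nu0.
have [le_n own fit inj match_u] := fa.
pose A := [set u | [forall v, e u v ==> (k <= price a v)]].
exists A.
pose T := [set v | k <= price a v].
apply: (@leq_ltn_trans #|T|).
  apply/subset_leq_card/subsetP=> v; rewrite !inE => /exists_inP[u].
  by rewrite inE => /forallP/(_ v)/implyP.
pose h v := odflt u0 (owner a v).
have hP v : v \in T -> owner a v = Some (h v).
  rewrite inE => kv; rewrite /h; have := own v (leq_trans k0 kv).
  by case: owner.
have h_inj : {in T &, injective h}.
  by move=> v w vT wT eq_h; apply: inj; rewrite hP // hP // eq_h.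
have u0A : u0 \in A.
  rewrite inE; apply/forallP=> v; apply/implyP => uv.
  case: (sa u0) => [au|/(_ v uv)]; first by rewrite au in nu0.
  exact: leq_trans.
rewrite -(card_in_imset h_inj) [X in _ < X](cardsD1 u0) u0A ltnS.
apply/subset_leq_card/subsetP=> _ /imsetP[v vT ->].
have [ah _ fith] := fit v (h v) (hP v vT).
rewrite !inE; apply/andP; split; first by apply: contraNneq nu0 => <-.
apply/forallP=> w; apply/implyP=> /fith le_w; rewrite -ltnS; apply: leq_trans le_w.
by move: vT; rewrite inE leq_eqVlt eq_sym (negbTE (no_k v)).
Qed.

End Auction.

(** * Bounded loop programs *)

Section LoopPrograms.

(** Counted loops replace [WhileNonzero], so that termination and running time follow from the
    syntax. In [LFor] the first register is the counter and the second the bound. *)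
Inductive loop_program :=
| LSet of nat & expr
| LWrite of expr & expr
| LSeq of loop_program & loop_program
| LIf of expr & loop_program & loop_program
| LFor of nat & nat & loop_program.

Definition increment (r : nat) : program := SetReg r (Plus (Reg r) (Const 1)).

Fixpoint compile (p : loop_program) : program :=
  match p with
  | LSet r x => SetReg r x
  | LWrite x y => Write x y
  | LSeq p q => Seq (compile p) (compile q)
  | LIf x p q => IfNonzero x (compile p) (compile q)
  | LFor r b p => Seq (SetReg r (Const 0))
      (WhileNonzero (Minus (Reg b) (Reg r)) (Seq (compile p) (increment r)))
  end.

Definition set_reg (s : state) (r x : nat) : state :=
  State (update (register s) r x) (memory s).

(** The bound of a loop is read once on entry, whereas the compiled loop reads it at every turn;
    [well_formed] makes both agree. *)
Fixpoint run (p : loop_program) (s : state) : state :=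
  match p with
  | LSet r x => set_reg s r (eval s x)
  | LWrite x y => State (register s) (update (memory s) (eval s x) (eval s y))
  | LSeq p q => run q (run p s)
  | LIf x p q => if eval s x != 0 then run p s else run q s
  | LFor r b p =>
      iter (register s b) (fun s => set_reg (run p s) r (register (run p s) r).+1)
        (set_reg s r 0)
  end.

Fixpoint written (p : loop_program) : seq nat :=
  match p with
  | LSet r _ => [:: r]
  | LWrite _ _ => [::]
  | LSeq p q | LIf _ p q => written p ++ written q
  | LFor r _ p => r :: written p
  end.

(* The registers in B are never written, so that their initial values bound the
   number of turns of every loop. *)
Fixpoint well_formed (B : seq nat) (p : loop_program) : bool :=
  match p with
  | LSet r _ => r \notin B
  | LWrite _ _ => true
  | LSeq p q | LIf _ p q => well_formed B p && well_formed B q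
  | LFor r b p => [&& r \notin B, b \in B, r \notin written p & well_formed B p]
  end.

(** The variable stands for a bound on the registers that bound loops. A loop pays 2 for its
    initialization and last test, and 2 more per turn for a test and an increment; a conditional
    pays for both branches. *)
Fixpoint cost (p : loop_program) : {poly nat} :=
  match p with
  | LSet _ _ | LWrite _ _ => 1
  | LSeq p q => cost p + cost q
  | LIf _ p q => 1 + (cost p + cost q)
  | LFor _ _ p => 2%:R + 'X * (cost p + 2%:R)
  end%R.

Lemma run_unwritten p s r : r \notin written p -> register (run p s) r = register s r.
Proof.
elim: p s => [r' x|x y|p IHp q IHq|x p IHp q IHq|r' b p IHp] s //=.
- by rewrite inE /update => /negbTE ->.
- by rewrite mem_cat negb_or => /andP[np nq]; rewrite IHq // IHp.
- by rewrite mem_cat negb_or => /andP[np nq]; case: ifP => _; [apply: IHp|apply: IHq].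
rewrite inE negb_or => /andP[/negbTE nr np].
elim: (register s b) => [|k IHk] /=; first by rewrite /update nr.
by rewrite /update nr IHp.
Qed.

Lemma well_formed_written B p r : well_formed B p -> r \in B -> r \notin written p.
Proof.
elim: p => [r' x|x y|p IHp q IHq|x p IHp q IHq|r' b p IHp] //=.
- by rewrite inE => nr' rB; apply: contraNneq nr' => <-.
- by move=> /andP[wp wq] rB; rewrite mem_cat negb_or IHp // IHq.
- by move=> /andP[wp wq] rB; rewrite mem_cat negb_or IHp // IHq.
- move=> /and4P[nr' _ _ wp] rB; rewrite inE negb_or IHp // andbT.
  by apply: contraNneq nr' => <-.
Qed.

Lemma exec_compile B M p s : well_formed B p ->
  {in B, forall r, register s r <= M} ->
  exists2 t, exec (compile p) s t (run p s) & t <= (cost p).[M]%R.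
Proof.
elim: p s => [r x|x y|p IHp q IHq|x p IHp q IHq|r b p IHp] s /=.
- by exists 1; [apply: exec_set_reg|rewrite hornerC].
- by exists 1; [apply: exec_write|rewrite hornerC].
- move=> /andP[wp wq] sM.
  have [t1 ex1 le1] := IHp s wp sM.
  have [|t2 ex2 le2] := IHq (run p s) wq.
    by move=> r rB; rewrite run_unwritten ?sM // (well_formed_written wp).
  exists (t1 + t2); first exact: exec_seq ex1 ex2.
  by rewrite hornerD; apply: leq_add.
- move=> /andP[wp wq] sM; case: ifP => [nz|/negbFE/eqP z].
    have [t ex le] := IHp s wp sM; exists t.+1; first exact: exec_if_true.
    by rewrite !hornerD hornerC; move: le; clear; lia.
  have [t ex le] := IHq s wq sM; exists t.+1; first exact: exec_if_false.
  by rewrite !hornerD hornerC; move: le; clear; lia.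
move=> /and4P[rB bB rp wp] sM.
have br : b != r by apply: contraNneq rB => <-.
have bp := well_formed_written wp bB.
pose body s := set_reg (run p s) r (register (run p s) r).+1.
rewrite -[iter _ _ _]/(iter (register s b) body (set_reg s r 0)); pose c := ((cost p).[M])%R.
(* Here [k] is the number of turns still to be made. *)
have loop k s' : register s' r + k = register s' b ->
    {in B, forall r, register s' r <= M} ->
    exists2 t, exec (WhileNonzero (Minus (Reg b) (Reg r)) (Seq (compile p) (increment r)))
      s' t (iter k body s') & t <= 1 + k * (c + 2).
  elim: k s' => [|k IHk] s' eq_rb s'M.
    by exists 1 => //; apply: exec_while_false; rewrite /= -eq_rb addn0 subnn.
  have [t1 ex1 le1] := IHp s' wp s'M.
  have body_b r' : r' != r -> register (body s') r' = register (run p s') r'.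
    by rewrite /body /= /update => /negbTE ->.
  have body_r : register (body s') r = (register s' r).+1.
    by rewrite /body /= /update eqxx run_unwritten.
  have [||t2 ex2 le2] := IHk (body s').
  - by rewrite body_r body_b // run_unwritten // -eq_rb addSnnS.
  - move=> r' r'B; rewrite body_b; last by apply: contraNneq rB => <-.
    by rewrite run_unwritten ?s'M // (well_formed_written wp).
  exists (t1 + 1 + t2).+1; last by rewrite mulSn; move: le1 le2; rewrite -/c; clear; lia.
  rewrite iterSr; apply: exec_while_true ex2; first by rewrite /= -eq_rb; move: eq_rb; clear; lia.
  apply: exec_seq ex1 _.
  have -> : body s' = set_reg (run p s') r (eval (run p s') (Plus (Reg r) (Const 1))).
    by rewrite /body /= addn1.
  exact: exec_set_reg.
have [||t ex le] := loop (register s b) (set_reg s r 0).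
- by rewrite /= /update eqxx (negbTE br).
- move=> r' r'B /=; rewrite /update; case: eqP => [//|_]; exact: sM.
exists (1 + t); first by apply: exec_seq ex; apply: exec_set_reg.
rewrite !hornerE -/c.
have leM := sM b bB.
have le2 : register s b * (c + 1 + 1) <= M * (c + 1 + 1) by rewrite leq_mul2r leM orbT.
apply: leq_trans (leq_add (leqnn (1 + 1)) le2).
by move: le; clear; lia.
Qed.

(** Invariant rule: [I k] describes the state after [k] turns, when the counter has just been set to
    [k]. *)
Lemma run_for (I : nat -> state -> Prop) r b p s :
  I 0 (set_reg s r 0) ->
  (forall k s', k < register s b -> register s' r = k -> I k s' ->
    I k.+1 (set_reg (run p s') r k.+1)) ->
  r \notin written p ->
  I (register s b) (run (LFor r b p) s).
Proof.
move=> I0 IS rp /=; pose body s := set_reg (run p s) r (register (run p s) r).+1.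
rewrite -[iter _ _ _]/(iter (register s b) body (set_reg s r 0)).
suff main k : k <= register s b ->
    I k (iter k body (set_reg s r 0)) /\ register (iter k body (set_reg s r 0)) r = k.
  exact: (main _ (leqnn _)).1.
elim: k => [_|k IHk lt_k] /=; first by split=> //; rewrite /update eqxx.
have [Ik rk] := IHk (ltnW lt_k).
rewrite {1 3}/body run_unwritten // rk; split; first exact: IS.
by rewrite /= /update eqxx.
Qed.

End LoopPrograms.

Lemma row_major_lt n i j : i < n -> j < n -> i * n + j < n * n.
Proof.
move=> lt_i lt_j; apply: leq_trans (_ : i.+1 * n <= _); last by rewrite leq_mul2r lt_i orbT.
by rewrite mulSn addnC ltn_add2r.
Qed.

(** * The auction as a program for the machine *)

Section AuctionProgram.

(* Register 0 holds the input length n * n and register 1 holds n.  The auction is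
   stored behind the adjacency matrix: prices from n * n on, then the owners
   (0 for none, i + 1 for vertex i), then the assignment flags. *)
Definition price_at x := Plus (Reg 0) x.
Definition owner_at x := Plus (Plus (Reg 0) (Reg 1)) x.
Definition assigned_at x := Plus (Plus (Plus (Reg 0) (Reg 1)) (Reg 1)) x.

(** Register 10 is never read, so this acts as an empty command. *)
Definition skip := LSet 10 (Const 0).

(** Register 4 is the bidder, 5 the candidate neighbour, 6 the least price so far, 7 the vertex
    attaining it plus one (0 for none), and 8 the offset of the bidder's matrix row. Register 6
    starts at [n], so that only prices below [n] qualify. *)
Definition search_body :=
  LIf (Read (Plus (Reg 8) (Reg 5)))
    (LIf (Minus (Reg 6) (Read (price_at (Reg 5))))
       (LSeq (LSet 6 (Read (price_at (Reg 5)))) (LSet 7 (Plus (Reg 5) (Const 1))))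
       skip)
    skip.

(** The previous owner is released before its entry is overwritten. *)
Definition assign_program :=
  LSeq (LSet 9 (Minus (Reg 7) (Const 1)))
  (LSeq (LIf (Read (owner_at (Reg 9)))
           (LWrite (assigned_at (Minus (Read (owner_at (Reg 9))) (Const 1))) (Const 0))
           skip)
  (LSeq (LWrite (owner_at (Reg 9)) (Plus (Reg 4) (Const 1)))
  (LSeq (LWrite (assigned_at (Reg 4)) (Const 1))
        (LWrite (price_at (Reg 9)) (Plus (Reg 6) (Const 1)))))).

Definition bid_program :=
  LIf (Read (assigned_at (Reg 4))) skip
    (LSeq (LSet 6 (Reg 1)) (LSeq (LSet 7 (Const 0))
       (LSeq (LFor 5 1 search_body) (LIf (Reg 7) assign_program skip)))).

(** The row offset advances by [n] at each turn, as the machine cannot multiply. *)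
Definition round_program :=
  LSeq (LSet 8 (Const 0))
    (LFor 4 1 (LSeq bid_program (LSet 8 (Plus (Reg 8) (Reg 1))))).

Definition check_body := LIf (Read (assigned_at (Reg 4))) skip (LSet 2 (Const 0)).

(** Register 0 provides the [n * n] rounds after which the auction is settled; register 2 receives
    the answer. *)
Definition auction_program :=
  LSeq (LFor 3 0 round_program) (LSeq (LSet 2 (Const 1)) (LFor 4 1 check_body)).

(** Register 2 is kept equal to the square of register 1 through (k+1)^2 = k^2 + k + k + 1, until it
    reaches the input length. *)
Definition root_body :=
  LIf (Minus (Reg 0) (Reg 2))
    (LSeq (LSet 2 (Plus (Plus (Plus (Reg 2) (Reg 1)) (Reg 1)) (Const 1)))
          (LSet 1 (Plus (Reg 1) (Const 1))))
    (LSet 3 (Const 0)).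

Definition root_program := LFor 4 0 root_body.

(** The two loop programs are compiled separately because the first computes register 1, which must
    be constant in the second, where it bounds loops. *)
Definition matching_program : program :=
  Seq (compile root_program) (Seq (compile auction_program) (SetReg 0 (Reg 2))).

Variable G : sgraph.
Local Notation n := #|G|.
Implicit Types (a b : auction G) (u v w : G) (s : state).

Definition owner_code (x : option G) : nat := if x is Some w then (enum_rank w).+1 else 0.

Definition represents a (m : nat -> nat) : Prop :=
  [/\ forall u v, m (enum_rank u * n + enum_rank v) = adj u v,
      forall v, m (n * n + enum_rank v) = price a v,
      forall v, m (n * n + n + enum_rank v) = owner_code (owner a v)
    & forall u, m (n * n + n + n + enum_rank u) = assigned a u].

Lemma vertex_of_index k : k < n -> exists w, k = enum_rank w.
Proof. by move=> lt; exists (enum_val (Ordinal lt)); rewrite enum_valK. Qed.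

Lemma rank_inj u v : (enum_rank u == enum_rank v :> nat) = (u == v).
Proof. by rewrite (inj_eq val_inj) (inj_eq enum_rank_inj). Qed.

Lemma matrix_address u v : enum_rank u * n + enum_rank v < n * n.
Proof. exact: row_major_lt. Qed.

Lemma run_search a u s :
  represents a (memory s) -> register s 0 = n * n -> register s 1 = n ->
  register s 8 = enum_rank u * n -> register s 6 = n -> register s 7 = 0 ->
  let s' := run (LFor 5 1 search_body) s in
  memory s' = memory s /\
  (register s' 7 = 0 /\ priced_out adj a u \/
   exists v, [/\ register s' 7 = (enum_rank v).+1, register s' 6 = price a v
               & cheapest adj a u v]).
Proof.
move=> [adjE priceE _ _] r0 r1 r8 r6 r7.
pose I k s' := [/\ memory s' = memory s,
  [/\ register s' 0 = n * n, register s' 1 = n & register s' 8 = enum_rank u * n],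
  forall w, enum_rank w < k -> adj u w -> register s' 6 <= price a w
  & register s' 7 = 0 /\ register s' 6 = n \/
    exists v, [/\ register s' 7 = (enum_rank v).+1, register s' 6 = price a v,
                  adj u v & price a v < n]].
have : I (register s 1) (run (LFor 5 1 search_body) s).
  apply: run_for => //; first by split=> //; left.
  move=> k s' lt_k r5 [mE [r0' r1' r8'] le best].
  rewrite r1 in lt_k; have [w kw] := vertex_of_index lt_k.
  have le_n : register s' 6 <= n.
    by case: best => [[_ ->]|[v [_ -> _ /ltnW]]].
  rewrite /search_body /= r8' r0' r5 kw mE adjE priceE.
  have [uw|nuw] := boolP (adj u w); last first.
    split=> //= x; rewrite ltnS leq_eqVlt rank_inj -kw => /orP[/eqP->|/le //].
    by rewrite (negbTE nuw).
  rewrite /= subn_eq0 -ltnNge; have [lt|ge] := ltnP (price a w) (register s' 6).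
    split=> //=; rewrite /update /= ?r5.
      move=> x; rewrite ltnS leq_eqVlt rank_inj => /orP[/eqP->//|xk ux].
      by apply: ltnW; apply: leq_trans lt (le x _ ux); rewrite kw.
    right; exists w; split=> //=; first by rewrite kw addn1.
    exact: leq_trans lt le_n.
  by split=> //= x; rewrite /update /= ltnS leq_eqVlt rank_inj -kw => /orP[/eqP->//|]; apply: le.
rewrite r1; case: (run _ _) => reg mem [/= -> _ le best]; split=> //.
have {}le w : adj u w -> reg 6 <= price a w by apply: le.
case: best => [[-> r6n]|[v [-> r6v uv lt]]]; [left|right].
  by split=> // w uw; rewrite -r6n le.
by exists v; split=> //; split=> // w uw; rewrite -r6v le.
Qed.

Lemma run_assign a u v s :
  represents a (memory s) -> register s 0 = n * n -> register s 1 = n ->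
  register s 4 = enum_rank u -> register s 6 = price a v ->
  register s 7 = (enum_rank v).+1 ->
  represents (assign a u v) (memory (run assign_program s)).
Proof.
move=> [adjE priceE ownerE assignedE] r0 r1 r4 r6 r7.
pose m0 := if owner a v is Some x
  then update (memory s) (n * n + n + n + enum_rank x) 0 else memory s.
have -> : memory (run assign_program s) =
    update (update (update m0 (n * n + n + enum_rank v) (enum_rank u).+1)
      (n * n + n + n + enum_rank u) 1) (n * n + enum_rank v) (price a v).+1.
  rewrite /m0 /assign_program /= /update /= r0 r1 r7 subn1 /= ownerE.
  by case: (owner a v) => [x|] /=; rewrite /update /= ?r0 ?r1 ?r4 ?r6 ?ownerE ?addn1 ?subn1.
have mem_lt := matrix_address; have rank_lt w : enum_rank w < n := ltn_ord _.
(* Releasing the previous owner touches only the assignment flags; the remaining work is to keep the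
   address ranges apart. *)
have m0E k : k < n * n + n + n -> m0 k = memory s k.
  rewrite /m0 /update; case: (owner a v) => [x|//] lt_k; case: eqP => // ek.
  by move: lt_k; rewrite ek ltnNge leq_addr.
split=> [w y|w|w|w]; rewrite /update /=.
- have lt := mem_lt w y.
  by rewrite !ltn_eqF ?m0E ?adjE // -?addnA; apply: leq_trans lt (leq_addr _ _).
- rewrite eqn_add2l rank_inj; case: eqP => // _.
  by rewrite !ltn_eqF ?m0E ?priceE // -!addnA !ltn_add2l ltn_addr ?rank_lt.
- rewrite eqn_add2l rank_inj gtn_eqF; last first.
    by rewrite -!addnA !ltn_add2l ltn_addr ?rank_lt.
  rewrite ltn_eqF; last by rewrite -!addnA !ltn_add2l ltn_addr ?rank_lt.
  by case: eqP => // _; rewrite m0E ?ownerE // -!addnA !ltn_add2l rank_lt.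
- rewrite eqn_add2l rank_inj gtn_eqF; last first.
    by rewrite -!addnA !ltn_add2l ltn_addr ?rank_lt.
  case: eqP => // _; rewrite gtn_eqF; last first.
    by rewrite -!addnA !ltn_add2l ltn_addr ?rank_lt.
  rewrite /m0; case: (owner a v) => [x|]; last exact: assignedE.
  rewrite /update eqn_add2l rank_inj assignedE.
  by rewrite (inj_eq Some_inj) eq_sym; case: eqP.
Qed.

Lemma run_bid a u s :
  represents a (memory s) -> register s 0 = n * n -> register s 1 = n ->
  register s 4 = enum_rank u -> register s 8 = enum_rank u * n ->
  exists2 b, bid adj a u b & represents b (memory (run bid_program s)).
Proof.
move=> rep r0 r1 r4 r8; have [_ _ _ assignedE] := rep.
pose s1 := set_reg (set_reg s 6 (register s 1)) 7 0.
pose s2 := run (LFor 5 1 search_body) s1.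
have -> : run bid_program s =
    if eval s (Read (assigned_at (Reg 4))) != 0 then run skip s
    else if register s2 7 != 0 then run assign_program s2 else run skip s2 by [].
have -> : eval s (Read (assigned_at (Reg 4))) = assigned a u by rewrite /= r0 r1 r4 assignedE.
rewrite eqb0 negbK.
have [au|nau] := boolP (assigned a u); first by exists a => //; apply: bid_none; left.
have [] := @run_search a u s1 rep r0 r1 r8 r1 erefl; rewrite -/s2 => mE.
have keep r : r \notin [:: 5; 6; 7; 10] -> register s2 r = register s r.
  rewrite !inE !negb_or => /and4P[/negbTE r_5 /negbTE r_6 /negbTE r_7 /negbTE r_10].
  rewrite run_unwritten; first by rewrite /= /update r_6 r_7.
  by rewrite /= !inE r_5 r_6 r_7 r_10.
case=> [[-> out]|[v [r7 r6 cheap]]].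
  by exists a; [apply: bid_none; right|rewrite /= mE].
clearbody s2; rewrite r7; exists (assign a u v); first exact: bid_assign.
change (represents (assign a u v) (memory (run assign_program s2))).
by apply: run_assign; rewrite ?mE // keep.
Qed.

Lemma run_round a s :
  represents a (memory s) -> register s 0 = n * n -> register s 1 = n ->
  exists2 b, bids adj a (enum G) b & represents b (memory (run round_program s)).
Proof.
move=> rep r0 r1.
pose I k s' := [/\ register s' 0 = n * n, register s' 1 = n, register s' 8 = k * n
  & exists2 b, bids adj a (take k (enum G)) b & represents b (memory s')].
pose s1 := set_reg s 8 0.
pose loop := LFor 4 1 (LSeq bid_program (LSet 8 (Plus (Reg 8) (Reg 1)))).
have -> : run round_program s = run loop s1 by [].
have : I (register s1 1) (run loop s1).
  apply: run_for => //; first by split=> //; exists a; rewrite ?take0 //; apply: bids_nil.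
  move=> k s' lt_k r4 [r0' r1' r8' [b ab rep_b]].
  have {}lt_k : k < n by rewrite -r1.
  have [w kw] := vertex_of_index lt_k.
  have [||c bc rep_c] := run_bid (u := w) rep_b r0' r1'; [by rewrite -kw|by rewrite -kw|].
  pose t := run bid_program s'.
  have [t0 t1 t8] : [/\ register t 0 = n * n, register t 1 = n & register t 8 = k * n].
    by split; rewrite run_unwritten.
  change (represents c (memory t)) in rep_c.
  change (I k.+1 (set_reg (set_reg t 8 (register t 8 + register t 1)) 4 k.+1)).
  clearbody t; split; rewrite //= /update /=; first by rewrite t8 t1 mulSn addnC.
  exists c => //; rewrite (take_nth w) -?cardE // kw nth_enum_rank -kw.
  exact: bids_rcons ab bc.
rewrite [register s1 1]r1 => -[_ _ _ [b]].
by rewrite take_oversize -?cardE // => ab rep_b; exists b.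
Qed.

Lemma run_rounds s :
  represents (start G) (memory s) -> register s 0 = n * n -> register s 1 = n ->
  exists2 b, rounds adj (n * n) b & represents b (memory (run (LFor 3 0 round_program) s)).
Proof.
move=> rep r0 r1.
pose I k s' := [/\ register s' 0 = n * n, register s' 1 = n
  & exists2 b, rounds adj k b & represents b (memory s')].
have : I (register s 0) (run (LFor 3 0 round_program) s).
  apply: run_for => //; first by split=> //; exists (start G) => //; apply: rounds0.
  move=> k s' _ _ [r0' r1' [b kb rep_b]].
  have [c bc rep_c] := run_round rep_b r0' r1'.
  have [t0 t1] : register (run round_program s') 0 = n * n /\
      register (run round_program s') 1 = n.
    by rewrite !run_unwritten.
  move: (run round_program s') rep_c t0 t1 => t rep_c t0 t1.
  by split=> //; exists c => //; apply: roundsS bc.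
by rewrite r0 => -[_ _].
Qed.

Lemma run_check a s :
  represents a (memory s) -> register s 0 = n * n -> register s 1 = n ->
  register s 2 = 1 ->
  register (run (LFor 4 1 check_body) s) 2 != 0 <-> forall u, assigned a u.
Proof.
move=> rep r0 r1 r2; have [_ _ _ assignedE] := rep.
pose I k s' := [/\ register s' 0 = n * n, register s' 1 = n, memory s' = memory s
  & register s' 2 != 0 <-> forall u, enum_rank u < k -> assigned a u].
have : I (register s 1) (run (LFor 4 1 check_body) s).
  apply: run_for => //; first by split=> //=; rewrite /update /= r2.
  move=> k s' lt_k r4 [r0' r1' mE IH].
  have {}lt_k : k < n by rewrite -r1.
  have [w kw] := vertex_of_index lt_k.
  rewrite /check_body /= r0' r1' r4 mE kw assignedE eqb0 negbK.
  have [aw|naw] := boolP (assigned a w); split; rewrite //= /update /=.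
    rewrite IH kw; split=> all_a x; last by move/ltnW; apply: all_a.
    by rewrite ltnS leq_eqVlt rank_inj => /orP[/eqP->//|]; apply: all_a.
  split=> // all_a; by move: naw; rewrite all_a.
by rewrite r1 => -[_ _ _ ->]; split=> all_a u; [apply: all_a|move=> _; apply: all_a].
Qed.

(** After [k] turns register 1 is [minn k n], and the [n * n] turns suffice because [n <= n * n]. *)
Lemma run_root s : register s 0 = n * n -> register s 1 = 0 -> register s 2 = 0 ->
  register (run root_program s) 1 = n /\ memory (run root_program s) = memory s.
Proof.
move=> r0 r1 r2.
pose I k s' := [/\ register s' 0 = n * n, register s' 1 = minn k n,
  register s' 2 = register s' 1 * register s' 1 & memory s' = memory s].
have : I (register s 0) (run root_program s).
  apply: run_for => //; first by split; rewrite //= /update /= ?r0 ?r1 ?r2 ?min0n.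
  move=> k s' _ _ [r0' r1' r2' mE].
  rewrite /root_body /= r0' r2' subn_eq0 -ltnNge !mulnn ltn_sqr r1'.
  have [lt|ge] := ltnP (minn k n) n.
    have lt_k : k < n by move: lt; rewrite gtn_min ltnn orbF.
    split; rewrite //= /update /= r1' (minn_idPl (ltnW lt_k)) ?addn1.
      by rewrite (minn_idPl lt_k).
    by rewrite -mulnn mulSn mulnS; clear; lia.
  have le_k : n <= k by move: ge; rewrite leq_min leqnn andbT.
  split; rewrite //= /update /= ?r2' // r1'.
  by rewrite (minn_idPr le_k) (minn_idPr (leqW le_k)).
rewrite r0 => -[_ -> _ ->]; split=> //; apply/minn_idPr.
by case: #|G| => // k; rewrite leq_pmulr.
Qed.

Lemma size_graph_code : size (graph_code G) = n * n.
Proof. by rewrite size_allpairs -cardE. Qed.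

Lemma nth_graph_code u v :
  nth false (graph_code G) (enum_rank u * n + enum_rank v) = adj u v.
Proof.
have nth_allpairs (s t : seq G) i j : i < size s -> j < size t ->
    nth false [seq adj x y | x <- s, y <- t] (i * size t + j) = adj (nth u s i) (nth u t j).
  elim: s i => // x s IHs [|i] lt_i lt_j /=; rewrite nth_cat size_map.
    by rewrite mul0n lt_j (nth_map u).
  by rewrite mulSn -addnA ltnNge leq_addr /= addKn IHs.
by rewrite {2}cardE nth_allpairs -?cardE // !nth_enum_rank.
Qed.

(** Cells behind the input hold 0, which encodes price zero, no owner and not assigned. *)
Lemma represents_start : represents (start G) (memory (initial_state (graph_code G))).
Proof.
have out k : n * n <= k -> memory (initial_state (graph_code G)) k = 0.
  by move=> le_k; rewrite /= nth_default // size_graph_code.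
split=> [u v|v|v|v]; first by rewrite /= nth_graph_code.
all: by rewrite out // -?addnA leq_addr.
Qed.

Definition matching_time : {poly nat} :=
  (cost root_program + (cost auction_program + 1))%R.

Lemma matching_program_spec : exists t s (a : auction G),
  [/\ exec matching_program (initial_state (graph_code G)) t s,
      t <= matching_time.[size (graph_code G)]%R,
      fair adj a, settled adj a & accepting s <-> forall u, assigned a u].
Proof.
set s0 := initial_state _; rewrite size_graph_code.
have r0 : register s0 0 = n * n by rewrite /= size_graph_code.
have le_n : n <= n * n by case: #|G| => // k; rewrite leq_pmulr.
have [t1 ex1 le1] := @exec_compile [:: 0] (n * n) root_program s0 isT
  (fun r => ltac:(by rewrite inE => /eqP->; rewrite r0)).
have [r1 m1] := @run_root s0 r0 erefl erefl.
have {r0} r0 : register (run root_program s0) 0 = n * n by rewrite run_unwritten.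
have rep1 : represents (start G) (memory (run root_program s0)).
  by rewrite m1; apply: represents_start.
move: (run root_program s0) ex1 r1 r0 rep1 {m1} => s1 ex1 r1 r0 rep1.
have [t2 ex2 le2] := @exec_compile [:: 0; 1] (n * n) auction_program s1 isT
  (fun r => ltac:(by rewrite !inE => /orP[]/eqP->; rewrite ?r0 ?r1)).
have [a rounds_a rep_a] := run_rounds rep1 r0 r1.
have [fair_a settled_a] := rounds_settled rounds_a.
pose s2 := run (LFor 3 0 round_program) s1.
have r20 : register s2 0 = n * n by rewrite run_unwritten.
have r21 : register s2 1 = n by rewrite run_unwritten.
pose s3 := run auction_program s1.
exists (t1 + (t2 + 1)), (set_reg s3 0 (register s3 2)), a.
split=> //.
- exact: exec_seq ex1 (exec_seq ex2 (exec_set_reg _ _ _)).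
- rewrite /matching_time hornerD (hornerD (cost auction_program)) hornerC.
  exact: (leq_add le1 (leq_add le2 (leqnn 1))).
- exact: (@run_check a (set_reg s2 2 1) rep_a r20 r21 erefl).
Qed.

End AuctionProgram.

(** * Outerplanar graphs *)

From mathcomp Require Import all_classical all_reals all_analysis.
Import Order.TTheory GRing.Theory Num.Theory.
Import numFieldNormedType.Exports.

(** * Half-turns and the non-planarity of K_{3,3} *)

Section HalfTurns.
Local Open Scope ring_scope.
Variable R : realFieldType.
Implicit Types (p q u v : R * R) (l m : seq (R * R)).

(** This half-plane is half-open in order to contain exactly one of [u] and [- u] for every nonzero
    [u]. *)
Definition upper u : bool := (0 < u.2) || (u.2 == 0) && (0 < u.1).

(* Signed crossing of the horizontal axis by the step from u to v: the number of
   half-turns around the origin, up to a coboundary. *)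
Definition half_turn u v : int :=
  ((upper v)%:Z - (upper u)%:Z) * (if 0 < u.1 then 1 else -1).

(* The bounding boxes of the steps pp' and qq' are disjoint. *)
Definition apart p p' q q' : bool :=
  [|| [&& p.1 < q.1, p.1 < q'.1, p'.1 < q.1 & p'.1 < q'.1],
      [&& q.1 < p.1, q'.1 < p.1, q.1 < p'.1 & q'.1 < p'.1],
      [&& p.2 < q.2, p.2 < q'.2, p'.2 < q.2 & p'.2 < q'.2]
    | [&& q.2 < p.2, q'.2 < p.2, q.2 < p'.2 & q'.2 < p'.2]].

Lemma upper_opp p q : p != q -> upper (p - q) = ~~ upper (q - p).
Proof.
case: p q => [p1 p2] [q1 q2]; rewrite /upper /= xpair_eqE !subr_gt0 !subr_eq0.
by case: (ltgtP p1 q1); case: (ltgtP p2 q2).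
Qed.

(** All four differences lie in one open half-plane bounded by a coordinate axis, so going around
    them makes no turn. *)
Lemma half_turn_quad p p' q q' : apart p p' q q' ->
  half_turn (p - q) (p' - q) + half_turn (p' - q) (p' - q') =
  half_turn (p - q) (p - q') + half_turn (p - q') (p' - q').
Proof.
case: p p' q q' => [p1 p2] [p1' p2'] [q1 q2] [q1' q2'].
rewrite /half_turn /upper /= !subr_gt0 !subr_eq0 /apart /=.
case/or4P => /and4P[h1 h2 h3 h4].
- by rewrite (lt_gtF h1) (lt_gtF h2) (lt_gtF h3) /=; ring.
- by rewrite h1 h2 h3; ring.
- rewrite (lt_gtF h1) (lt_gtF h2) (lt_gtF h3) (lt_gtF h4) /=.
  by rewrite (lt_eqF h1) (lt_eqF h2) (lt_eqF h3) (lt_eqF h4) /=; ring.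
- by rewrite h1 h2 h3 h4 /= !subrr !mul0r.
Qed.

(** For opposite vectors both [upper] and the side of the vertical axis are reversed, and the signs
    cancel. If the vectors stay on one side of the horizontal axis, both terms vanish. *)
Lemma half_turn_opp p q q' : apart p p q q' ->
  half_turn (p - q) (p - q') = half_turn (q - p) (q' - p).
Proof.
case: p q q' => [p1 p2] [q1 q2] [q1' q2'].
rewrite /half_turn /upper /= !subr_gt0 !subr_eq0 /apart /=.
case/or4P => /and4P[h1 h2 _ _].
- rewrite (lt_gtF h1) (lt_gtF h2) h1 h2 /= !andbF !orbF !andbT.
  by case: (ltgtP p2 q2) => _; case: (ltgtP p2 q2') => _.
- rewrite (lt_gtF h1) (lt_gtF h2) h1 h2 /= !andbF !orbF !andbT.
  by case: (ltgtP p2 q2) => _; case: (ltgtP p2 q2') => _.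
- rewrite (lt_gtF h1) (lt_gtF h2) (lt_eqF h1) (lt_eqF h2) h1 h2 /=.
  by rewrite !subrr !mul0r.
- rewrite (lt_gtF h1) (lt_gtF h2) (lt_eqF h1) (lt_eqF h2) h1 h2 /=.
  by rewrite !subrr !mul0r.
Qed.

Fixpoint turning p a l : int :=
  if l is b :: l' then half_turn (a - p) (b - p) + turning p b l' else 0.

Fixpoint steps (a : R * R) l : seq ((R * R) * (R * R)) :=
  if l is b :: l' then (a, b) :: steps b l' else [::].

Definition paths_apart a l b m : Prop :=
  forall s t, s \in steps a l -> t \in steps b m -> apart s.1 s.2 t.1 t.2.

Lemma turning_cat p a l m :
  turning p a (l ++ m) = turning p a l + turning p (last a l) m.
Proof. by elim: l a => [|b l IHl] a /=; rewrite ?add0r // IHl addrA. Qed.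

(** Modulo 2 the sign in [half_turn] disappears and the sum telescopes. *)
Lemma turning_parity p a l :
  exists k : int, turning p a l = (upper (last a l - p))%:Z - (upper (a - p))%:Z + k * 2.
Proof.
elim: l a => [|b l IHl] a /=; first by exists 0; ring.
have [k ->] := IHl b; rewrite /half_turn; case: ifP => _; first by exists k; ring.
exists (k + (upper (a - p))%:Z - (upper (b - p))%:Z); ring.
Qed.

Lemma turning_strip a a' b m : paths_apart a [:: a'] b m ->
  half_turn (a - b) (a' - b) + turning a' b m =
  turning a b m + half_turn (a - last b m) (a' - last b m).
Proof.
elim: m b => [|c m IHm] b /= ap; first by rewrite addr0 add0r.
have /= ap1 : apart a a' b c by apply: (ap (a, a') (b, c)); rewrite ?inE eqxx.
have ap' : paths_apart a [:: a'] c m.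
  by move=> s t sa tm; apply: ap => //; rewrite inE tm orbT.
have apl : apart a a b c by move: ap1; rewrite /apart => /or4P[] /and4P[-> -> _ _]; rewrite ?orbT.
have apr : apart a' a' b c.
  move: ap1; rewrite /apart => /or4P[] /and4P[h1 h2 h3 h4];
    by rewrite ?h1 ?h2 ?h3 ?h4 ?orbT.
rewrite -(half_turn_opp apl) -(half_turn_opp apr).
rewrite addrA (half_turn_quad ap1) -addrA (IHm c ap') addrA.
by [].
Qed.

(** The difference of two points moving on disjoint paths never vanishes, so it has no winding along
    the boundary of the parameter rectangle; the rectangle is cut into the cells of
    [half_turn_quad]. *)
Lemma turning_square a l b m : paths_apart a l b m ->
  turning b a l + turning (last a l) b m = turning a b m + turning (last b m) a l.
Proof.
elim: l a => [|c l IHl] a /= ap; first by rewrite addr0 add0r.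
have ap1 : paths_apart a [:: c] b m.
  by move=> s t; rewrite inE => /eqP-> tm; apply: ap; rewrite ?inE ?eqxx.
have apl : paths_apart c l b m.
  by move=> s t sl tm; apply: ap => //; rewrite inE sl orbT.
by rewrite -addrA (IHl c apl) addrA (turning_strip ap1) addrA.
Qed.

Lemma paths_apart_cat a l l' b m : paths_apart a l b m ->
  paths_apart (last a l) l' b m -> paths_apart a (l ++ l') b m.
Proof.
move=> ap ap' s t; have -> : steps a (l ++ l') = steps a l ++ steps (last a l) l'.
  by elim: (l) (a) => //= c k IHk d; rewrite IHk.
by rewrite mem_cat => /orP[sl|sl]; [apply: ap|apply: ap'].
Qed.

(* The van Kampen obstruction of K_{3,3}: only independent edges are required to
   be disjoint. *)
Lemma no_K33 (x y z : R * R) (m : nat -> R * R) (A B Z : nat -> seq (R * R)) :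
  x != y -> (forall i, x != m i) -> (forall i, y != m i) ->
  (forall i, last x (A i) = m i) -> (forall i, last (m i) (B i) = y) ->
  (forall i, last (m i) (Z i) = z) ->
  (forall i j, i < 3 -> j < 3 -> i != j ->
     [/\ paths_apart x (A i) (m j) (B j), paths_apart x (A i) (m j) (Z j)
       & paths_apart (m i) (B i) (m j) (Z j)])%N ->
  False.
Proof.
move=> xy xm ym lA lB lZ ap.
pose D i p := turning p x (A i ++ B i).
have DE i p : D i p = turning p x (A i) + turning p (m i) (B i).
  by rewrite /D turning_cat lA.
have E1 i j : (i < 3)%N -> (j < 3)%N -> i != j ->
    turning (m j) x (A i) + turning (m i) (m j) (B j) =
    turning x (m j) (B j) + turning y x (A i).
  by move=> i3 j3 ij; have [/turning_square + _ _] := ap i j i3 j3 ij; rewrite lA lB.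
have E2 i k : (i < 3)%N -> (k < 3)%N -> i != k ->
    D i (m k) - D i z = turning x (m k) (Z k) - turning y (m k) (Z k).
  move=> i3 k3 ik; have [_ apA apB] := ap i k i3 k3 ik.
  have /turning_square : paths_apart x (A i ++ B i) (m k) (Z k).
    by apply: paths_apart_cat; rewrite ?lA.
  rewrite -/(D i _) -/(D i _) last_cat lA lB lZ => /eqP.
    by rewrite eq_sym -subr_eq -addrAC eq_sym -subr_eq => /eqP <-; ring.
have P1 i k : exists n, D i (m k) = (upper (y - m k))%:Z - (upper (x - m k))%:Z + n * 2.
  by have := turning_parity (m k) x (A i ++ B i); rewrite last_cat lA lB.
have P2 i : exists n, D i z = (upper (y - z))%:Z - (upper (x - z))%:Z + n * 2.
  by have := turning_parity z x (A i ++ B i); rewrite last_cat lA lB.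
(* Three differences among [x], [y] and [m k] have to be reversed, which accounts for the odd
   term. *)
have P3 k : exists n, turning y x (A k) + turning x (m k) (B k) =
    (upper (y - m k))%:Z - (upper (x - m k))%:Z + 1 + n * 2.
  have [n1 ->] := turning_parity y x (A k); have [n2 ->] := turning_parity x (m k) (B k).
  rewrite lA lB (upper_opp xy) (upper_opp (xm k)) (upper_opp (ym k)).
  exists (n1 + n2 + (upper (y - x))%:Z - 1 + (upper (m k - y))%:Z - (upper (m k - x))%:Z).
  by case: (upper _); case: (upper _); case: (upper _); rewrite /=; ring.
(* Let w_k be the left side in [P3 k] and c_k the right side of [E2 i k], which does not depend on
   i. Adding [E1 i j] and [E1 j i] gives w_i + w_j = D_i(z) + c_i + D_j(z) + c_j, and the three
   pairs force w_i = D_i(z) + c_i. For k distinct from i, this has by [P2] the parity of D_k(z) +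
   c_i = D_k(m_i), whereas [P1] and [P3] give opposite parities. *)
have := E1 0 1 isT isT isT; have := E1 0 2 isT isT isT; have := E1 1 0 isT isT isT.
have := E1 1 2 isT isT isT; have := E1 2 0 isT isT isT; have := E1 2 1 isT isT isT.
have := E2 0 1 isT isT isT; have := E2 0 2 isT isT isT; have := E2 1 0 isT isT isT.
have := E2 1 2 isT isT isT; have := E2 2 0 isT isT isT; have := E2 2 1 isT isT isT.
have [n01 p01] := P1 0 1; have [n02 p02] := P1 0 2; have [n10 p10] := P1 1 0.
have [n12 p12] := P1 1 2; have [n20 p20] := P1 2 0; have [n21 p21] := P1 2 1.
have [z0 q0] := P2 0; have [z1 q1] := P2 1; have [z2 q2] := P2 2.
have [r0 s0] := P3 0; have [r1 s1] := P3 1; have [r2 s2] := P3 2.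
rewrite !p01 !p02 !p10 !p12 !p20 !p21 !q0 !q1 !q2.
move: p01 p02 p10 p12 p20 p21 s0 s1 s2; rewrite !DE.
lia.
Qed.

End HalfTurns.

(** * Chains in connected sets and distances from compact sets *)

Section Chains.
Local Open Scope classical_set_scope.
Local Open Scope ring_scope.
Variable R : realType.
Implicit Types (p q : R * R) (l : seq (R * R)) (A K L : set (R * R)).

(** The points reachable from [a] form a subset both open and closed in [A]; closedness uses that
    nearby points are related in both directions. *)
Lemma connected_chain A (E : R * R -> R * R -> Prop) : connected A ->
  (forall a, A a -> \forall b \near a, A b -> E a b /\ E b a) ->
  forall a b, A a -> A b ->
  exists2 l, last a l = b & forall s, s \in steps a l -> E s.1 s.2.
Proof.
move=> cA nearE a b Aa Ab.
pose reach c := exists2 l, last a l = c & forall s, s \in steps a l -> E s.1 s.2.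
have reach_step c d : reach c -> E c d -> reach d.
  move=> [l lc El] Ecd; exists (rcons l d); first by rewrite last_rcons.
  have -> : steps a (rcons l d) = rcons (steps a l) (c, d).
    by rewrite -lc; elim: (l) (a) => //= e k IHk f; rewrite IHk.
  by move=> s; rewrite mem_rcons inE => /orP[/eqP->|/El].
suff AE : A `&` reach = A.
  by have [_] : (A `&` reach) b by rewrite AE.
have near_reach c : A c -> \forall d \near c, A d -> (reach c <-> reach d).
  move=> Ac; near=> d => Ad; have [||Ecd Edc] := near (nearE c Ac) d => //.
  by split=> rc; [apply: reach_step rc Ecd|apply: reach_step rc Edc].
apply: cA.
- by exists a; split=> //; exists [::].
- exists (interior [set c | A c -> reach c]); first exact: open_interior.
  apply/seteqP; split=> c [Ac rc]; split=> //.
    by apply: filterS (near_reach c Ac) => d rcd Ad; apply/rcd.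
  exact: (nbhs_singleton rc).
- exists (~` interior [set c | A c -> ~ reach c]).
    exact/open_closedC/open_interior.
  apply/seteqP; split=> c [Ac rc]; split=> //.
    by move=> /nbhs_singleton /(_ Ac).
  apply: contrapT => nrc; apply: rc.
  by apply: filterS (near_reach c Ac) => d rcd Ad rd; apply: nrc; apply/(rcd Ad).
Unshelve. all: by end_near. Qed.

Definition far K L (e : R) : Prop := forall p q, K p -> L q -> ~ ball p e q.

(** Compactness, in its near-covering form, makes the local distance to [L] uniform over [K]. *)
Lemma compact_far K L : compact K -> closed L -> K `&` L = set0 ->
  \forall e \near 0^'+, far K L e.
Proof.
move=> /compact_near_coveringP cK cL KL0.
have : \forall e \near 0^'+, K `<=` (fun p => forall q, L q -> ~ ball p e q).
  apply: cK => p Kp.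
  have : nbhs p (~` L).
    apply: open_nbhs_nbhs; split; first exact: closed_openC.
    by move=> Lp; have : (K `&` L) p by []; rewrite KL0.
  move=> /nbhs_ballP[r /= r0 pr].
  near=> p' e.
  have e_r : e <= r / 2 by near: e; apply: nbhs_right_le; rewrite divr_gt0.
  move=> q Lq pq; apply: (pr q) Lq.
  have pp' : ball p (r / 2) p' by near: p'; apply: nbhsx_ballx; rewrite divr_gt0.
  have p'q : ball p' (r / 2) q by apply: le_ball pq.
  by rewrite (splitr r); apply: ball_triangle pp' p'q.
by apply: filterS => e Ke p q Kp; apply: Ke.
Unshelve. all: by end_near. Qed.

(** Balls are squares, so some coordinate of [p] and [q] differs by at least [e + e], and two steps
    shorter than [e] cannot close this gap. *)
Lemma far_apart p p' q q' (e : R) :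
  ball p e p' -> ball q e q' -> ~ ball p (e + e) q -> apart p p' q q'.
Proof.
case: p p' q q' => [p1 p2] [p1' p2'] [q1 q2] [q1' q2'].
rewrite /ball /= /prod_ball /= /ball /= => -[] hp1 hp2 [hq1 hq2].
move: hp1 hp2 hq1 hq2; rewrite !ltr_norml => /andP[a1 a2] /andP[b1 b2] /andP[c1 c2] /andP[d1 d2].
move=> far_pq; rewrite /apart /=.
have [lt1|ge1] := ltP `|p1 - q1| (e + e).
  have [lt2|] := ltP `|p2 - q2| (e + e); first by case: far_pq; rewrite -!ltr_norml.
  rewrite ler_normr => /orP[ge|ge].
    by apply/orP; right; apply/orP; right; apply/orP; right; repeat (apply/andP; split); lra.
  by apply/orP; right; apply/orP; right; apply/orP; left; repeat (apply/andP; split); lra.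
move: ge1; rewrite ler_normr => /orP[ge|ge].
  by apply/orP; right; apply/orP; left; repeat (apply/andP; split); lra.
by apply/orP; left; repeat (apply/andP; split); lra.
Qed.

End Chains.

(** * Discretization of an outerplanar drawing *)

Section Outerplanar.
Local Open Scope classical_set_scope.
Local Open Scope ring_scope.
Variables (R : realType) (G : sgraph) (d : planar_drawing R G).
Local Notation pt := (vertex_point d).
Local Notation curve u v := (edge_curve d u v @` `[0, 1]).

Lemma curve_compact (u v : G) : adj u v -> compact (curve u v).
Proof.
move=> uv; apply: continuous_compact; last exact: segment_compact.
exact: edge_curve_continuous.
Qed.

Lemma curve_closed (u v : G) : adj u v -> closed (curve u v).
Proof. by move=> uv; apply: compact_closed (curve_compact uv); apply: norm_hausdorff. Qed.

Lemma curve_connected (u v : G) : adj u v -> connected (curve u v).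
Proof.
move=> uv; apply: connected_continuous_connected; first exact: segment_connected.
exact: edge_curve_continuous.
Qed.

Lemma curve_start (u v : G) : adj u v -> curve u v (pt u).
Proof.
by move=> uv; exists 0; [rewrite /= in_itv /= lexx ler01|apply: edge_curve_start].
Qed.

Lemma curve_end (u v : G) : adj u v -> curve u v (pt v).
Proof.
by move=> uv; exists 1; [rewrite /= in_itv /= lexx ler01|apply: edge_curve_end].
Qed.

Lemma curveP (u v : G) p : adj u v -> curve u v p ->
  [\/ p = pt u, p = pt v | exists2 t : R, t \in `]0, 1[ & p = edge_curve d u v t].
Proof.
move=> uv [t /= t01 <-]; move: t01; rewrite in_itv /= => /andP[].
rewrite le_eqVlt => /orP[/eqP <- _|t0]; first by apply: Or31; apply: edge_curve_start.
rewrite le_eqVlt => /orP[/eqP ->|t1]; first by apply: Or32; apply: edge_curve_end.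
by apply: Or33; exists t; rewrite // in_itv /= t0.
Qed.

Lemma vertex_curve_disjoint (w u v : G) : adj u v -> w != u -> w != v ->
  ~ curve u v (pt w).
Proof.
move=> uv wu wv /(curveP uv)[||[t t01]].
- by move/(@vertex_point_inj _ _ d)/eqP; rewrite (negbTE wu).
- by move/(@vertex_point_inj _ _ d)/eqP; rewrite (negbTE wv).
- by move/esym; apply: edge_curve_vertex.
Qed.

Lemma curves_disjoint (a b u v : G) : adj a b -> adj u v ->
  a \notin [:: u; v] -> b \notin [:: u; v] -> curve a b `&` curve u v = set0.
Proof.
move=> ab uv; rewrite !inE !negb_or => /andP[au av] /andP[bu bv].
rewrite -subset0 => p [] /(curveP ab)[->|->|[t t01 ->]].
- exact: vertex_curve_disjoint.
- exact: vertex_curve_disjoint.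
case/(curveP uv) => [||[t' t01']]; try exact: edge_curve_vertex.
apply: edge_curve_disjoint => // -[] /eqP; first by rewrite (negbTE au).
by rewrite (negbTE av).
Qed.

Lemma curves_far : \forall e \near 0^'+, forall a b u v : G, adj a b -> adj u v ->
  a \notin [:: u; v] -> b \notin [:: u; v] -> far (curve a b) (curve u v) e.
Proof.
apply: filter_forall => a; apply: filter_forall => b.
apply: filter_forall => u; apply: filter_forall => v.
have [ab|nab] := boolP (adj a b); last by apply: nearW.
have [uv|nuv] := boolP (adj u v); last by apply: nearW.
have [au|nau] := boolP (a \notin [:: u; v]); last by apply: nearW.
have [bu|nbu] := boolP (b \notin [:: u; v]); last by apply: nearW.
have := compact_far (curve_compact ab) (curve_closed uv) (curves_disjoint ab uv au bu).
by apply: filterS => e fe _ _ _ _.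
Qed.

Lemma vertex_curve_far : \forall e \near 0^'+, forall w u v : G, adj u v ->
  w != u -> w != v -> far [set pt w] (curve u v) e.
Proof.
apply: filter_forall => w; apply: filter_forall => u; apply: filter_forall => v.
have [uv|nuv] := boolP (adj u v); last by apply: nearW.
have [wu|nwu] := boolP (w != u); last by apply: nearW.
have [wv|nwv] := boolP (w != v); last by apply: nearW.
have dis : [set pt w] `&` curve u v = set0.
  by rewrite -subset0 => p [->]; apply: vertex_curve_disjoint.
have := compact_far (@compact_set1 _ (pt w)) (curve_closed uv) dis.
by apply: filterS => e fe _ _ _.
Qed.

Lemma undrawn_far p : ~ drawn_set d p ->
  \forall e \near 0^'+, far [set p] (drawn_set d) e.
Proof.
move=> np.
have far_v : \forall e \near 0^'+, forall v, far [set p] [set pt v] e.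
  apply: filter_forall => v; apply: compact_far; first exact: compact_set1.
    by apply: compact_closed (@compact_set1 _ _); apply: norm_hausdorff.
  by rewrite -subset0 => q [-> pv]; apply: np; left; exists v.
have far_e : \forall e \near 0^'+, forall u v, adj u v -> far [set p] (curve u v) e.
  apply: filter_forall => u; apply: filter_forall => v.
  have [uv|nuv] := boolP (adj u v); last by apply: nearW.
  have dis : [set p] `&` curve u v = set0.
    by rewrite -subset0 => q [-> pv]; apply: np; right; exists u, v.
  have := compact_far (@compact_set1 _ p) (curve_closed uv) dis.
  by apply: filterS => e fe _.
near=> e => q s -> [[v ->]|[u [v [uv s_uv]]]].
  by have := near far_v e => /(_ _); apply.
have : forall u v, adj u v -> far [set p] (curve u v) e by near: e.
by move=> /(_ u v uv); apply.
Unshelve. all: by end_near. Qed.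

Section FaceWithAllVertices.
Variable z : R * R.
Hypothesis z_out : ~ drawn_set d z.
Let F := connected_component (~` drawn_set d) z.

(** The clearance [r + r] is what [far_apart] needs against curve steps shorter than [r]. The radius
    may change from step to step, since a face can come arbitrarily close to the drawing. *)
Definition face_step (r : R) p q : Prop :=
  ball p r q /\ far [set p] (drawn_set d) (r + r).

Lemma face_chain p : F p ->
  exists2 l, last p l = z & forall s, s \in steps p l -> exists2 r, 0 < r & face_step r s.1 s.2.
Proof.
move=> Fp; have Fz : F z by apply: connected_component_refl.
apply: (connected_chain (E := fun a b => exists2 r, 0 < r & face_step r a b)
  (@component_connected _ _ _) _ Fp Fz) => a Fa.
have a_out : ~ drawn_set d a by apply: (connected_component_sub Fa).
have [e [e0 far_e]] : exists e : R, 0 < e /\ far [set a] (drawn_set d) e.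
  by apply: (@filter_ex _ (0^'+)); apply: filterI (undrawn_far a_out); apply: nbhs_right_gt.
(* With a quarter of [e], the point [b] near [a] still has the clearance [e / 2] required by the
   reverse step. *)
have r0 : 0 < e / 4 by rewrite divr_gt0.
near=> b => _.
have ab : ball a (e / 4) b by near: b; apply: nbhsx_ballx.
split; exists (e / 4) => //; split.
- exact: ab.
- by move=> _ q -> Dq /(le_ball (e2 := e)) aq; apply: (far_e a q) => //; apply: aq; lra.
- exact: ball_sym.
- move=> _ q -> Dq bq; apply: (far_e a q) => //.
  by apply: le_ball (ball_triangle ab bq); lra.
Unshelve. all: by end_near. Qed.

Lemma curve_chain (delta : R) (u v : G) : 0 < delta -> adj u v ->
  exists2 l, last (pt u) l = pt v & forall s, s \in steps (pt u) l ->
    [/\ ball s.1 delta s.2, curve u v s.1 & curve u v s.2].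
Proof.
move=> delta0 uv.
apply: (connected_chain (E := fun a b => [/\ ball a delta b, curve u v a & curve u v b])
  (curve_connected uv) _ (curve_start uv) (curve_end uv)) => a Ka.
near=> b => Kb; have ab : ball a delta b by near: b; apply: nbhsx_ballx.
by split; split=> //; apply: ball_sym.
Unshelve. all: by end_near. Qed.

Lemma uniform_radius (Q : R -> (R * R) * (R * R) -> Prop) (l : seq ((R * R) * (R * R))) :
  (forall s, s \in l -> exists2 r, 0 < r & Q r s) ->
  exists2 e, 0 < e & forall s, s \in l -> exists2 r, e <= r & Q r s.
Proof.
elim: l => [|s l IHl] Ql; first by exists 1.
have [r r0 Qr] := Ql s (mem_head _ _).
have [e e0 Qe] := IHl (fun t tl => Ql t (mem_behead (s := s :: l) tl)).
exists (Num.min e r) => [|t]; first by rewrite lt_min e0.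
rewrite inE => /orP[/eqP->|/Qe[r' er' Qr']]; first by exists r; rewrite // ge_min lexx orbT.
by exists r'; rewrite // ge_min er'.
Qed.

Hypothesis all_vertices : forall v, closure F (pt v).

Lemma apart_sym (p p' q q' : R * R) : apart p p' q q' = apart q q' p p'.
Proof.
rewrite /apart; set a := [&& _, _, _ & _]; set b := [&& _, _, _ & _].
set c := [&& _, _, _ & _]; set e := [&& _, _, _ & _].
have -> : [&& q.1 < p.1, q.1 < p'.1, q'.1 < p.1 & q'.1 < p'.1] = b.
  by rewrite /b; do !case: (_ < _).
have -> : [&& p.1 < q.1, p'.1 < q.1, p.1 < q'.1 & p'.1 < q'.1] = a.
  by rewrite /a; do !case: (_ < _).
have -> : [&& q.2 < p.2, q.2 < p'.2, q'.2 < p.2 & q'.2 < p'.2] = e.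
  by rewrite /e; do !case: (_ < _).
have -> : [&& p.2 < q.2, p'.2 < q.2, p.2 < q'.2 & p'.2 < q'.2] = c.
  by rewrite /c; do !case: (_ < _).
by case: a; case: b; case: c; case: e.
Qed.

(* The first step of a face path jumps from the vertex into the face. *)
Lemma discrete_drawing :
  exists (edge_chain : G -> G -> seq (R * R)) (face_path : G -> seq (R * R)),
  [/\ forall u v, adj u v -> last (pt u) (edge_chain u v) = pt v,
      forall v, last (pt v) (face_path v) = z,
      forall a b u v, adj a b -> adj u v ->
        a \notin [:: u; v] -> b \notin [:: u; v] ->
        paths_apart (pt a) (edge_chain a b) (pt u) (edge_chain u v)
    & forall w u v, adj u v -> w != u -> w != v ->
        paths_apart (pt u) (edge_chain u v) (pt w) (face_path w)].
Proof.
have [e [e0 [far_cc far_vc]]] : exists e : R, 0 < e /\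
    ((forall a b u v : G, adj a b -> adj u v -> a \notin [:: u; v] -> b \notin [:: u; v] ->
      far (curve a b) (curve u v) e) /\
    (forall w u v : G, adj u v -> w != u -> w != v -> far [set pt w] (curve u v) e)).
  apply: (@filter_ex _ (0^'+)); apply: filterI; first exact: nbhs_right_gt.
  exact: filterI curves_far vertex_curve_far.
pose r := e / 2; have r0 : 0 < r by rewrite divr_gt0.
have rr : r + r = e by rewrite /r -splitr.
have /choice[fp fpP] v : exists al : (R * R) * seq (R * R),
    [/\ ball (pt v) r al.1, last al.1 al.2 = z &
      forall s, s \in steps al.1 al.2 -> exists2 r, 0 < r & face_step r s.1 s.2].
  have [a [Fa va]] := all_vertices (nbhsx_ballx (pt v) r r0).
  by have [l lz lP] := face_chain Fa; exists (a, l).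
(* The face paths are fixed first: their finitely many steps have a least radius, and the curves are
   then cut into steps at most that long. *)
have [delta' d0' dP] : exists2 e, 0 < e & forall s,
    s \in flatten [seq steps (fp v).1 (fp v).2 | v <- enum G] ->
    exists2 r, e <= r & face_step r s.1 s.2.
  apply: uniform_radius => s /flattenP[_ /mapP[v _ ->]].
  by have [_ _] := fpP v; apply.
pose delta := Num.min delta' r.
have d0 : 0 < delta by rewrite lt_min d0'.
have /choice[ch chP] (uv : G * G) : exists l, adj uv.1 uv.2 ->
    last (pt uv.1) l = pt uv.2 /\ forall s, s \in steps (pt uv.1) l ->
      [/\ ball s.1 delta s.2, curve uv.1 uv.2 s.1 & curve uv.1 uv.2 s.2].
  have [uv_adj|] := boolP (adj uv.1 uv.2); last by exists [::].
  by have [l ? ?] := curve_chain d0 uv_adj; exists l.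
have dr : delta <= r by rewrite ge_min lexx orbT.
exists (fun u v => ch (u, v)), (fun v => (fp v).1 :: (fp v).2); split.
- by move=> u v /(chP (u, v))[].
- by move=> v; have [] := fpP v.
- move=> a b u v ab uv au bu s t.
  move=> /(proj2 (chP (a, b) ab))[sd s1 s2] /(proj2 (chP (u, v) uv))[td t1 t2].
  apply: (far_apart (e := r)); try exact: le_ball dr _ _.
  by rewrite rr; apply: far_cc s1 t1.
- move=> w u v uv wu wv s t /(proj2 (chP (u, v) uv))[sd s1 s2].
  rewrite apart_sym /= inE => /orP[/eqP->|tl] /=.
    have [wr _ _] := fpP w.
    apply: (far_apart (e := r)) => //; first exact: le_ball dr _ _.
    by rewrite rr; apply: (far_vc w u v uv wu wv _ _ erefl s1).
  have [r' dr' [tr' far_t]] : exists2 r, delta' <= r & face_step r t.1 t.2.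
    apply: dP; apply/flattenP; exists (steps (fp w).1 (fp w).2) => //.
    by apply/mapP; exists w; rewrite ?mem_enum.
  apply: (far_apart (e := r')) => //.
    apply: le_ball sd; apply: le_trans dr'; by rewrite ge_min lexx.
  apply: far_t => //; right; exists u, v; split=> //.
Qed.

End FaceWithAllVertices.

(** * Polylines along graph paths, and the exclusion of thetas *)

Section Polyline.
Variable edge_chain : G -> G -> seq (R * R).
Hypothesis edge_chain_last : forall u v, adj u v -> last (pt u) (edge_chain u v) = pt v.

Fixpoint polyline (u : G) (p : seq G) : seq (R * R) :=
  if p is v :: p' then edge_chain u v ++ polyline v p' else [::].

Lemma last_polyline u p : path adj u p -> last (pt u) (polyline u p) = pt (last u p).
Proof.
by elim: p u => //= v p IHp u /andP[uv vp]; rewrite last_cat edge_chain_last // IHp.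
Qed.

Lemma polyline_apart u p b m : path adj u p ->
  (forall v w, adj v w -> v \in u :: p -> w \in u :: p ->
    paths_apart (pt v) (edge_chain v w) b m) ->
  paths_apart (pt u) (polyline u p) b m.
Proof.
elim: p u => [|v p IHp] u //= /andP[uv vp] ap.
apply: paths_apart_cat; first by apply: ap; rewrite ?inE ?eqxx ?orbT.
rewrite edge_chain_last //; apply: IHp => // a c ac av cv.
by apply: ap; rewrite // inE ?av ?cv orbT.
Qed.

End Polyline.

Lemma paths_apart_sym (a b : R * R) l m : paths_apart a l b m -> paths_apart b m a l.
Proof. by move=> ap s t sl tm; rewrite apart_sym; apply: ap. Qed.

End Outerplanar.

(** The sides of the K_{3,3} are [x], [y], [z] and the first inner vertices [m i] of the three
    paths. [A] draws the first edge of a path, [B] the rest of it, and [Z] the connection to the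
    point [z] of the face. *)
Lemma outerplanar_no_theta (R : realType) (G : sgraph) :
  outerplanar R G -> ~ theta (@adj G).
Proof.
move=> [d [_ [[[z z_out ->] _] all_v]]].
move=> [x [y [p1 [p2 [p3 [[n1 n2 n3] [pp1 pp2 pp3] uniq_p]]]]]].
have [ch [fp [ch_last fp_last cc_apart cf_apart]]] := discrete_drawing z_out all_v.
(* The default [p3] serves as the third path and makes the facts on single paths hold for every
   [i]. *)
pose p i := nth p3 [:: p1; p2] i.
have pn i : p i != [::] by case: i => [|[|[|i]]].
have pp i : path adj x (rcons (p i) y) by case: i => [|[|[|i]]].
pose m i := head x (p i); pose t i := behead (p i).
have pE i : p i = m i :: t i by rewrite /m /t; case: (p i) (pn i).
have mp i : m i \in p i by rewrite pE mem_head.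
move: uniq_p; rewrite /= !inE !mem_cat !negb_or !cat_uniq.
rewrite has_cat negb_or => /and3P[/and4P[xy xp1 xp2 xp3] /and3P[yp1 yp2 yp3]].
case/and3P => _ /andP[/hasPn d12 /hasPn d13] /and3P[_ /hasPn d23 _].
have xp i : x \notin p i by case: i => [|[|[|i]]].
have yp i : y \notin p i by case: i => [|[|[|i]]].
have disj i j v : (i < 3)%N -> (j < 3)%N -> i != j -> v \in p i -> v \notin p j.
  case: i => [|[|[|i]]] //; case: j => [|[|[|j]]] // _ _ _ vi; apply/negP => vj.
  - by move: (d12 v vj); rewrite /= vi.
  - by move: (d13 v vj); rewrite /= vi.
  - by move: (d12 v vi); rewrite /= vj.
  - by move: (d23 v vj); rewrite /= vi.
  - by move: (d13 v vi); rewrite /= vj.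
  - by move: (d23 v vi); rewrite /= vj.
have pt_neq u v : u != v -> vertex_point d u != vertex_point d v.
  by move=> uv; rewrite (inj_eq (@vertex_point_inj _ _ d)).
have pxm i : path adj x [:: m i] by move: (pp i); rewrite pE /= => /andP[-> _].
have pmy i : path adj (m i) (rcons (t i) y) by move: (pp i); rewrite pE /= => /andP[_].
have mt i : m i :: rcons (t i) y = rcons (p i) y by rewrite pE.
have ym i : y != m i by apply: contraNneq (yp i) => ->.
have xm i : x != m i by apply: contraNneq (xp i) => ->.
have apart_face j u q : path adj u q -> m j \notin u :: q ->
    paths_apart (vertex_point d u) (polyline ch u q) (vertex_point d (m j)) (fp (m j)).
  move=> uq mj; apply: (polyline_apart ch_last) => // v w vw vq wq.
  by apply: cf_apart => //; apply: contraNneq mj => ->.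
apply: (no_K33 (x := vertex_point d x) (y := vertex_point d y) (z := z)
  (m := fun i => vertex_point d (m i)) (A := fun i => polyline ch x [:: m i])
  (B := fun i => polyline ch (m i) (rcons (t i) y)) (Z := fun i => fp (m i))).
- exact: pt_neq.
- by move=> i; apply: pt_neq.
- by move=> i; apply: pt_neq.
- by move=> i; rewrite (last_polyline ch_last).
- by move=> i; rewrite (last_polyline ch_last) // last_rcons.
- by move=> i; apply: fp_last.
move=> i j i3 j3 ij; have mj := disj j i (m j) j3 i3 _ (mp j).
rewrite eq_sym in mj; have {}mj := mj ij; have mi := disj i j (m i) i3 j3 ij (mp i).
split.
- apply: (polyline_apart ch_last) => // a b ab ax bx.
  apply: paths_apart_sym; apply: (polyline_apart ch_last) => // u v uv up vp.
  rewrite mt !mem_rcons in up vp.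
  have sep c w : c \in [:: x; m i] -> w \in y :: p j -> c != w.
    rewrite !inE => /orP[]/eqP-> /orP[/eqP->|wp] //.
    - by apply: contraTneq wp => <-.
    - by rewrite eq_sym.
    - by apply: contraTneq wp => <-.
  by apply: cc_apart => //; rewrite !inE negb_or; apply/andP; split; rewrite eq_sym; apply: sep.
- apply: apart_face => //; rewrite !inE negb_or eq_sym xm /=.
  by apply: contraNneq mj => ->.
- apply: apart_face => //; rewrite mt mem_rcons inE negb_or mj andbT.
  by rewrite eq_sym.
Qed.

Lemma outerplanar_theta_free (R : realType) (G : sgraph) :
  outerplanar R G -> bipartite_theta_free G.
Proof.
move=> /outerplanar_no_theta no_theta S T _ _ [x [y [p1 [p2 [p3 [n [pp1 pp2 pp3] uniq_p]]]]]].
have sub : subrel (bipartite_adj (@adj G) S T) adj by move=> u v /andP[].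
by apply: no_theta; exists x, y, p1, p2, p3; split; rewrite // !(sub_path sub).
Qed.

Theorem corollary3p12 (R : realType) :
  polynomial_time_decidable graph_code
    (fun G : sgraph => outerplanar R G \/ block_graph G)
    (fun G : sgraph => outcome_D G).
Proof.
exists matching_program, matching_time => G promise.
have theta_free : bipartite_theta_free G.
  case: promise => [/outerplanar_theta_free //|]; exact: block_graph_theta_free.
have [t [s [a [ex_t le_t fair_a settled_a accept_s]]]] := matching_program_spec G.
exists t, s; split=> //; rewrite accept_s; split=> [all_a|win u].
  have [f f_inj f_adj] := settled_matching fair_a all_a.
  exact: injective_neighbour_outcome_D f_inj f_adj.
apply: contraT => nu; have [A ltA] := settled_violator fair_a settled_a nu.
case: (hall_violator_not_outcome_D (A := A) theta_free _ win).
suff -> : nbrs adj [set: G] A = [set v | [exists u in A, adj u v]]%SET by [].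
by apply/setP=> v; rewrite !inE.
Qed.
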